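(* Let $\mathcal{E}_4=\{\ket{\psi_1},\ket{\psi_2},\ket{\psi_3},\ket{\psi_4}\}\subset\mathbb{C}^2\otimes\mathbb{C}^2$ be a set of four pairwise orthogonal normalized pure states ($\langle\psi_i|\psi_j\rangle=\delta_{ij}$), each sampled with probability $1/4$. Then $\mathcal{E}_4$ is two-copy distinguishable under adaptive LOCC if and only if one of the following holds: (i) the set is perfectly distinguishable by LOCC from a single copy (the second copy is not needed at all); (ii) there is an LOCC protocol on the first copy that leads with certainty to the conclusion that the given state belongs to the group $\mathcal{G}_l=\{\ket{\psi_l}\}$ or to its complement $\mathcal{G}_l^{\mathsf{C}}=\mathcal{E}_4\setminus\mathcal{G}_l$, for some $l\in\{1,2,3,4\}$, such that $\mathcal{G}_l^{\mathsf{C}}$ contains no more than one entangled state; (iii) there is an LOCC protocol on the first copy that leads with certainty to the conclusion that the given state belongs to the group $\mathcal{G}_{ij}=\{\ket{\psi_i},\ket{\psi_j}\}$ or to its complement, for some $i\neq j$ in $\{1,2,3,4\}$, such that the projectors $\mathbb{P}_{ij}:=\ket{\psi_i}\bra{\psi_i}+\ket{\psi_j}\bra{\psi_j}$ and $\mathbb{P}_{ij}^{\mathsf{C}}:=\mathbf{I}_4-\mathbb{P}_{ij}$ are both separable.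
   Context: Two spatially separated parties (Alice holding the first qubit, Bob the second) are given $k$ copies $\ket{\psi_i}^{\otimes k}$ of an unknown state drawn from a known ensemble and must identify $i$ with certainty. In an adaptive LOCC strategy each copy is addressed individually by local quantum operations and classical communication (LOCC) acting on that copy only, and the strategy used on later copies may depend on the outcomes obtained from earlier copies. ''Two-copy distinguishable under adaptive LOCC'' means perfect identification is possible with such a strategy using two copies. A positive operator on $\mathbb{C}^2\otimes\mathbb{C}^2$ is separable if it is a nonnegative combination of product operators $A\otimes B$ with $A,B\ge 0$; a state is entangled if it is not a product state. *)

(* Defs.v *)
From HB Require Import structures.
From mathcomp Require Import all_boot all_order all_algebra.
From mathcomp Require Import reals.
From mathcomp Require Import complex mxtens.
From Stdlib Require Lists.List.

Set Implicit Arguments.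
Unset Strict Implicit.
Unset Printing Implicit Defensive.

Import Order.TTheory GRing.Theory Num.Theory.
Local Open Scope ring_scope.

Section QDefs.
Variable R : realType.
Local Notation C := R[i].

Definition adj {m n} (A : 'M[C]_(m, n)) : 'M[C]_(n, m) := (map_mx Num.conj A)^T.

Definition psd2 (A : 'M[C]_2) : Prop :=
  adj A = A /\ forall v : 'cV[C]_2, 0 <= (adj v *m A *m v) 0 0.

(** Separable positive operator on C^2 (x) C^2 (Alice = first tensor factor):
    a finite nonnegative combination of products A (x) B with A, B >= 0
    (the nonnegative coefficients are absorbed into the A's). *)
Definition separable (P : 'M[C]_(2 * 2)) : Prop :=
  exists (n : nat) (A B : 'I_n -> 'M[C]_2),
    (forall k, psd2 (A k)) /\ (forall k, psd2 (B k)) /\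
    P = \sum_(k < n) (A k *t B k).

Definition entangled (psi : 'cV[C]_(2 * 2)) : Prop :=
  ~ exists (a b : 'cV[C]_2), psi = a *t b.

Definition proj (psi : 'cV[C]_(2 * 2)) : 'M[C]_(2 * 2) := psi *m adj psi.

Definition orthonormal4 (psi : 'I_4 -> 'cV[C]_(2 * 2)) : Prop :=
  forall i j, adj (psi i) *m psi j = (i == j)%:R%:M.

End QDefs.

(** Finite-round LOCC protocols acting on one copy of C^2 (x) C^2, whose
    leaves carry a label of type L.  At a node Alice (resp. Bob) performs a
    local quantum instrument with Kraus operators K_1..K_r (2x2 matrices,
    acting as K (x) I, resp. I (x) K), broadcasts the outcome, and the
    protocol continues with the subprotocol attached to that outcome. *)
Inductive locc (C : Type) (L : Type) : Type :=
| Leaf : L -> locc C L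
| NodeA : seq ('M[C]_2 * locc C L) -> locc C L
| NodeB : seq ('M[C]_2 * locc C L) -> locc C L.

Arguments Leaf {C L}.
Arguments NodeA {C L}.
Arguments NodeB {C L}.

Section LOCCSem.
Variable R : realType.
Local Notation C := R[i].
Variable L : Type.

Fixpoint locc_wf (P : locc C L) : Prop :=
  match P with
  | Leaf _ => True
  | NodeA ks | NodeB ks =>
      \sum_(kp <- ks) (adj kp.1 *m kp.1) = 1%:M /\
      (fix all_wf (s : seq ('M[C]_2 * locc C L)) : Prop :=
         match s with
         | [::] => True
         | kp :: s' => locc_wf kp.2 /\ all_wf s'
         end) ks
  end.

Fixpoint locc_leaves (P : locc C L) : seq ('M[C]_(2 * 2) * L) :=
  match P with
  | Leaf l => [:: (1%:M, l)]
  | NodeA ks =>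
      (fix go (s : seq ('M[C]_2 * locc C L)) :=
         match s with
         | [::] => [::]
         | kp :: s' =>
             [seq (M *m (kp.1 *t (1%:M : 'M[C]_2)), l) | '(M, l) <- locc_leaves kp.2]
             ++ go s'
         end) ks
  | NodeB ks =>
      (fix go (s : seq ('M[C]_2 * locc C L)) :=
         match s with
         | [::] => [::]
         | kp :: s' =>
             [seq (M *m ((1%:M : 'M[C]_2) *t kp.1), l) | '(M, l) <- locc_leaves kp.2]
             ++ go s'
         end) ks
  end.

End LOCCSem.

Section Disc.
Variable R : realType.
Local Notation C := R[i].

Definition locc_perfect (psi : 'I_4 -> 'cV[C]_(2 * 2)) : Prop :=
  exists P : locc C unit, locc_wf P /\
    forall Ml, Stdlib.Lists.List.In Ml (locc_leaves P) -> forall i k : 'I_4,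
      Ml.1 *m psi i != 0 -> Ml.1 *m psi k != 0 -> i = k.

Definition locc_separates_group (psi : 'I_4 -> 'cV[C]_(2 * 2)) (G : {set 'I_4}) :
  Prop :=
  exists P : locc C unit, locc_wf P /\
    forall Ml, Stdlib.Lists.List.In Ml (locc_leaves P) ->
      (forall k, k \notin G -> Ml.1 *m psi k = 0) \/
      (forall k, k \in G -> Ml.1 *m psi k = 0).

(** Two-copy adaptive LOCC: an LOCC protocol on the first copy, whose every
    outcome selects an LOCC protocol on the second copy; at every pair of
    outcomes at most one state has nonzero probability (the probability of
    outcome pair (M1,M2) for state psi_i is ||M1 psi_i||^2 ||M2 psi_i||^2). *)
Definition two_copy_adaptive_locc (psi : 'I_4 -> 'cV[C]_(2 * 2)) : Prop :=
  exists S : locc C (locc C unit), locc_wf S /\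
    forall M1P, Stdlib.Lists.List.In M1P (locc_leaves S) ->
      locc_wf M1P.2 /\
      forall M2l, Stdlib.Lists.List.In M2l (locc_leaves M1P.2) -> forall i k : 'I_4,
        M1P.1 *m psi i != 0 -> M2l.1 *m psi i != 0 ->
        M1P.1 *m psi k != 0 -> M2l.1 *m psi k != 0 -> i = k.

End Disc.

(* Main.v *)
Require Import Defs.
From HB Require Import structures.
From mathcomp Require Import all_boot all_order all_algebra.
From mathcomp Require Import reals.
From mathcomp Require Import complex mxtens.
From mathcomp Require Import ring zify.
From mathcomp Require boolp.
Import Order.TTheory GRing.Theory Num.Theory.
Local Open Scope ring_scope.

(* Two orthogonal states can always be told apart by one-way LOCC, and so can three
   orthogonal states two of which are products; this gives the "if" part.  Moreover the
   effects of an LOCC protocol are separable, so the two separability conditions of (iii)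
   follow from the existence of the protocol separating {psi_i, psi_j}.

   For the "only if" part, two orthogonal product states yield (iii) directly, so assume
   at most one state is a product.  If some outcome on the first copy eliminates no
   state, the second copy alone identifies the state, which is (i).  The key fact is
   about protocols all of whose outcomes leave at most two survivors.  Each outcome is
   then a rank-one product effect e (x) f, and it has a companion outcome e (x) f' or
   e' (x) f that branched off when the other party still had full rank.  An entangled
   state cannot be orthogonal to both, so the two survivor sets are complementary pairs
   G and its complement.  This rules out outcomes with three survivors on the first
   copy, since one of the two pairs contains two of the three.  Since psi_i0 and psi_j,
   with G = {i0, j}, are orthogonal, a second, non-parallel outcome with the same
   survivors G exists; it and its companion complete the first two vectors to a one-way
   product basis that separates G from its complement. *)

Section TwoQubit.
Set Implicit Arguments.
Unset Strict Implicit.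
Variable R : realType.
Local Notation C := R[i].
Local Notation In := Stdlib.Lists.List.In.

(** * Inner products and product vectors *)

Lemma adjE m n (A : 'M[C]_(m, n)) i j : adj A i j = (A j i)^*.
Proof. by rewrite !mxE. Qed.

Lemma adjK m n (A : 'M[C]_(m, n)) : adj (adj A) = A.
Proof. by apply/matrixP => i j; rewrite !adjE conjCK. Qed.

Lemma adjM m n p (A : 'M[C]_(m, n)) (B : 'M[C]_(n, p)) :
  adj (A *m B) = adj B *m adj A.
Proof. by rewrite /adj map_mxM trmx_mul. Qed.

Lemma adj_mx1 n : adj (1%:M : 'M[C]_n) = 1%:M.
Proof. by rewrite /adj map_scalar_mx rmorph1 trmx1. Qed.

Lemma adjZ m n c (A : 'M[C]_(m, n)) : adj (c *: A) = c^* *: adj A.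
Proof. by apply/matrixP => i j; rewrite !mxE rmorphM. Qed.

Lemma adj_tens m n p q (A : 'M[C]_(m, n)) (B : 'M[C]_(p, q)) :
  adj (A *t B) = adj A *t adj B.
Proof. by rewrite /adj map_mxT trmx_tens. Qed.

Definition ip n (v w : 'cV[C]_n) : C := (adj v *m w) 0 0.

Lemma ipE n (v w : 'cV[C]_n) : ip v w = \sum_i (v i 0)^* * w i 0.
Proof. by rewrite /ip mxE; apply: eq_bigr => i _; rewrite adjE. Qed.

Lemma adj_mul_ip n (v w : 'cV[C]_n) : adj v *m w = (ip v w)%:M.
Proof. by rewrite [LHS]mx11_scalar. Qed.

Lemma ipDr n (v w1 w2 : 'cV[C]_n) : ip v (w1 + w2) = ip v w1 + ip v w2.
Proof. by rewrite /ip mulmxDr mxE. Qed.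

Lemma ipBr n (v w1 w2 : 'cV[C]_n) : ip v (w1 - w2) = ip v w1 - ip v w2.
Proof. by rewrite /ip mulmxBr !mxE. Qed.

Lemma ipZr n c (v w : 'cV[C]_n) : ip v (c *: w) = c * ip v w.
Proof. by rewrite /ip -scalemxAr mxE. Qed.

Lemma ip_conj n (v w : 'cV[C]_n) : (ip v w)^* = ip w v.
Proof.
rewrite !ipE rmorph_sum; apply: eq_bigr => i _.
by rewrite rmorphM /= conjCK mulrC.
Qed.

Lemma ipDl n (v w1 w2 : 'cV[C]_n) : ip (w1 + w2) v = ip w1 v + ip w2 v.
Proof. by rewrite -ip_conj ipDr rmorphD /= !ip_conj. Qed.

Lemma ipZl n c (v w : 'cV[C]_n) : ip (c *: v) w = c^* * ip v w.
Proof. by rewrite -ip_conj ipZr rmorphM /= ip_conj. Qed.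

Lemma ip0r n (v : 'cV[C]_n) : ip v 0 = 0.
Proof. by rewrite /ip mulmx0 mxE. Qed.

Lemma ip_ge0 n (v : 'cV[C]_n) : 0 <= ip v v.
Proof.
by rewrite ipE; apply: sumr_ge0 => i _; rewrite mulrC mul_conjC_ge0.
Qed.

Lemma ip_eq0 n (v : 'cV[C]_n) : (ip v v == 0) = (v == 0).
Proof.
apply/eqP/eqP => [|->]; last by rewrite ip0r.
rewrite ipE => /eqP; rewrite psumr_eq0 => [/allP h|i _]; last first.
  by rewrite mulrC mul_conjC_ge0.
apply/matrixP => i j; rewrite ord1 mxE; apply/eqP.
by have := h i (mem_index_enum i); rewrite mulrC mul_conjC_eq0.
Qed.

Lemma ip_sym0 n (v w : 'cV[C]_n) : (ip v w == 0) = (ip w v == 0).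
Proof. by rewrite -ip_conj conjC_eq0. Qed.

Lemma ip_adjl m n (A : 'M[C]_(m, n)) v w : ip (A *m v) w = ip v (adj A *m w).
Proof. by rewrite /ip adjM mulmxA. Qed.

Lemma ip_mulmx m n (A : 'M[C]_(m, n)) v w :
  ip (A *m v) (A *m w) = ip v ((adj A *m A) *m w).
Proof. by rewrite ip_adjl mulmxA. Qed.

Lemma rank1_mulmx m n (u : 'cV[C]_m) (e v : 'cV[C]_n) :
  u *m adj e *m v = ip e v *: u.
Proof. by rewrite -mulmxA adj_mul_ip mul_mx_scalar. Qed.

Definition kron (a b : 'cV[C]_2) : 'cV[C]_(2 * 2) := a *t b.

Lemma adj_kron a b : adj (kron a b) = adj a *t adj b.
Proof. exact: (@adj_tens 2 1 2 1 a b). Qed.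

Lemma tens_kron (X Y : 'M[C]_2) a b : X *t Y *m kron a b = kron (X *m a) (Y *m b).
Proof. exact: (tensmx_mul X Y a b). Qed.

Lemma ip_kron a b c d : ip (kron a b) (kron c d) = ip a c * ip b d.
Proof.
have h := tensmx_mul (adj a) (adj b) c d.
by rewrite /ip adj_kron {1}/kron h mxE !ord1.
Qed.

Lemma rank1_tens (u e v f : 'cV[C]_2) :
  (u *m adj e) *t (v *m adj f) = kron u v *m adj (kron e f).
Proof. by rewrite adj_kron; apply/esym/(tensmx_mul u v (adj e) (adj f)). Qed.

Lemma kron_eq0 a b : (kron a b == 0) = (a == 0) || (b == 0).
Proof. by rewrite -ip_eq0 ip_kron mulf_eq0 !ip_eq0. Qed.

Lemma kronZl c a b : kron (c *: a) b = c *: kron a b.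
Proof. by apply/matrixP => i j; rewrite !mxE mulrA. Qed.

Lemma kronZr c a b : kron a (c *: b) = c *: kron a b.
Proof. by apply/matrixP => i j; rewrite !mxE mulrCA. Qed.

Lemma kronDl a a' b : kron (a + a') b = kron a b + kron a' b.
Proof. by apply/matrixP => i j; rewrite !mxE mulrDl. Qed.

Lemma kronDr a b b' : kron a (b + b') = kron a b + kron a b'.
Proof. by apply/matrixP => i j; rewrite !mxE mulrDr. Qed.

Lemma kronE a b : kron a b = a *t b.
Proof. by []. Qed.

(** The antilinear spin flip, an involution up to sign. It sends [e] to an orthogonal vector of the
    same norm, so [e] and [perp e] form an orthogonal basis whenever [e] is nonzero. *)
Definition perp (e : 'cV[C]_2) : 'cV[C]_2 :=
  \col_i (if i == 0 then - (e 1 0)^* else (e 0 0)^*).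

Lemma ip2E (v w : 'cV[C]_2) : ip v w = (v 0 0)^* * w 0 0 + (v 1 0)^* * w 1 0.
Proof.
rewrite ipE !big_ord_recl big_ord0 addr0; congr (_ + (v _ _)^* * w _ _); exact: val_inj.
Qed.

Lemma col2P (v w : 'cV[C]_2) : v 0 0 = w 0 0 -> v 1 0 = w 1 0 -> v = w.
Proof.
move=> h0 h1; apply/matrixP => i j; rewrite ord1.
case: i => [[|[|//]] hi].
- by rewrite (_ : Ordinal hi = 0) //; apply: val_inj.
- by rewrite (_ : Ordinal hi = 1) //; apply: val_inj.
Qed.

Lemma perp_perp e : perp (perp e) = - e.
Proof. by apply: col2P; rewrite !mxE /= ?rmorphN /= ?conjCK. Qed.

Lemma ip_perp e : ip e (perp e) = 0.
Proof. by rewrite ip2E !mxE /=; ring. Qed.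

Lemma ip_perp2 e : ip (perp e) (perp e) = ip e e.
Proof. by rewrite !ip2E !mxE /= rmorphN /= !conjCK; ring. Qed.

Lemma perp_eq0 e : (perp e == 0) = (e == 0).
Proof. by rewrite -!ip_eq0 ip_perp2. Qed.

(** The expansion of [v] in the basis [e], [perp e], multiplied by the squared norm of [e] so that
    no vector has to be normalised. *)
Lemma ip_decomp e v : ip e e *: v = ip e v *: e + ip (perp e) v *: perp e.
Proof. by apply: col2P; rewrite !ip2E !mxE /= rmorphN /= !conjCK; ring. Qed.

Lemma decomp_mx e : e *m adj e + perp e *m adj (perp e) = (ip e e)%:M.
Proof.
apply/trmx_inj/row_matrixP => i; rewrite -!tr_col; congr trmx.
rewrite !colE mulmxDl !rank1_mulmx mul_scalar_mx; exact/esym/ip_decomp.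
Qed.

Lemma ip_perp_flip (v w : 'cV[C]_2) : ip v (perp w) = - (ip (perp v) w)^*.
Proof. by rewrite !ip2E !mxE /= rmorphD !rmorphM /= rmorphN /= !conjCK; ring. Qed.

Lemma perp_par e v : e != 0 -> ip e v = 0 -> exists c, v = c *: perp e.
Proof.
move=> e0 ev; exists (ip (perp e) v / ip e e).
have := ip_decomp e v; rewrite ev scale0r add0r => h.
by rewrite mulrC -scalerA -h scalerA mulVf ?scale1r // ip_eq0.
Qed.

Lemma par_perp e v : e != 0 -> ip (perp e) v = 0 -> exists c, v = c *: e.
Proof.
move=> e0 ev; have := @perp_par (perp e) v; rewrite perp_eq0 perp_perp.
by case/(_ e0 ev) => c ->; exists (- c); rewrite scalerN scaleNr.
Qed.

Lemma par_neq0 n c (v w : 'cV[C]_n) : v != 0 -> v = c *: w -> c != 0.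
Proof.
by move=> v0 vE; apply: contraNneq v0 => c0; rewrite vE c0 scale0r.
Qed.


Opaque kron perp.

Lemma tens_scalar (a b : C) : (a%:M : 'M_2) *t (b%:M : 'M_2) = (a * b)%:M.
Proof.
apply/matrixP => i j; case: (mxtens_indexP i) => i1 i2; case: (mxtens_indexP j) => j1 j2.
rewrite tensmxE !mxE (can_eq (@mxtens_indexK 2 2)) xpair_eqE.
by do 2 case: eqP => _ /=; rewrite ?mulr1n ?mulr0n ?mulr0 ?mul0r.
Qed.

Lemma tensDl m n p q (A B : 'M[C]_(m, n)) (D : 'M[C]_(p, q)) :
  (A + B) *t D = A *t D + B *t D.
Proof. by apply/matrixP => i j; rewrite !mxE mulrDl. Qed.

Lemma tensDr m n p q (A : 'M[C]_(m, n)) (B D : 'M[C]_(p, q)) :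
  A *t (B + D) = A *t B + A *t D.
Proof. by apply/matrixP => i j; rewrite !mxE mulrDr. Qed.

Lemma kron_decomp (e f : 'cV[C]_2) w : (ip e e * ip f f) *: w =
  ip (kron e f) w *: kron e f + ip (kron e (perp f)) w *: kron e (perp f) +
  (ip (kron (perp e) f) w *: kron (perp e) f +
   ip (kron (perp e) (perp f)) w *: kron (perp e) (perp f)).
Proof.
rewrite -mul_scalar_mx -tens_scalar -!decomp_mx tensDl !tensDr !rank1_tens.
by rewrite !mulmxDl !rank1_mulmx.
Qed.

Lemma scale_unentangled c a b (w : 'cV[C]_(2 * 2)) :
  c != 0 -> c *: w = kron a b -> ~ entangled w.
Proof.
move=> c0 h; apply; exists (c^-1 *: a), b.
by rewrite -kronE kronZl -h scalerK.
Qed.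

Lemma ip_neq0 n (v : 'cV[C]_n) : v != 0 -> ip v v != 0.
Proof. by rewrite ip_eq0. Qed.

(** Two of the four coefficients in [kron_decomp] vanish and the other two terms share the left
    factor [perp e], so [w] would be a product. *)
Lemma entangled_left (e f : 'cV[C]_2) w : e != 0 -> f != 0 -> entangled w ->
  ip (kron e f) w = 0 -> ip (kron e (perp f)) w = 0 -> False.
Proof.
move=> e0 f0 went h1 h2; have := kron_decomp e f w.
rewrite h1 h2 !scale0r !add0r -!kronZr -kronDr => h.
by apply: scale_unentangled h went; rewrite mulf_neq0 ?ip_neq0.
Qed.

Lemma entangled_right (e f : 'cV[C]_2) w : e != 0 -> f != 0 -> entangled w ->
  ip (kron e f) w = 0 -> ip (kron (perp e) f) w = 0 -> False.
Proof.
move=> e0 f0 went h1 h2; have := kron_decomp e f w.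
rewrite h1 h2 !scale0r !add0r -!kronZl -kronDl => h.
by apply: scale_unentangled h went; rewrite mulf_neq0 ?ip_neq0.
Qed.

(** * Completeness of four orthonormal states *)

Section Basis.
Variable psi : 'I_4 -> 'cV[C]_(2 * 2).
Hypothesis psi_on : orthonormal4 psi.

Lemma ip_psi i j : ip (psi i) (psi j) = (i == j)%:R.
Proof. by rewrite /ip psi_on mxE eqxx mulr1n. Qed.

Lemma psi_neq0 i : psi i != 0.
Proof. by rewrite -ip_eq0 ip_psi eqxx oner_eq0. Qed.

(** The matrix [U] with columns [psi j] is square, so [adj U *m U = 1] gives [U *m adj U = 1], which
    is the resolution of the identity read entrywise. *)
Lemma sum_proj : \sum_k proj (psi k) = 1%:M.
Proof.
pose U : 'M[C]_4 := \matrix_(r, j) psi j r 0.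
have UU : adj U *m U = 1%:M.
  apply/matrixP => i j; rewrite !mxE -ip_psi ipE.
  by apply: eq_bigr => k _; rewrite !mxE.
apply/matrixP => i j; have /matrixP/(_ i j) := mulmx1C UU.
rewrite mxE summxE => hij; rewrite -[RHS]hij.
by apply: eq_bigr => k _; rewrite mxE big_ord1 !mxE.
Qed.

Lemma parseval v w : ip v w = \sum_k ip v (psi k) * ip (psi k) w.
Proof.
rewrite -[w in LHS]mul1mx -sum_proj mulmx_suml /ip mulmx_sumr summxE.
apply: eq_bigr => k _; rewrite /proj -mulmxA [adj (psi k) *m w]adj_mul_ip.
by rewrite mulmxA mul_mx_scalar [LHS]mxE mulrC [(_%:M : 'M_1) 0 0]mxE eqxx mulr1n.
Qed.

Lemma basis_ext (A B : 'M[C]_(2 * 2)) : (forall k, A *m psi k = B *m psi k) -> A = B.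
Proof.
move=> h; rewrite -[A]mulmx1 -[B]mulmx1 -sum_proj !mulmx_sumr.
by apply: eq_bigr => k _; rewrite /proj !mulmxA h.
Qed.

End Basis.

(** * LOCC protocols and their leaves *)


Lemma In_map (S T : Type) (h : S -> T) s y :
  In y [seq h x | x <- s] <-> exists x, In x s /\ h x = y.
Proof.
elim: s => [|a s IH] /=; first by split=> // -[x []].
split=> [[<-|h1]|[x [[<- <-|xs hx]]]]; [| | by left |].
- by exists a; split; [left|].
- by have [x [xs hx]] := (IH.1 h1); exists x; split; [right|].
- by right; apply/IH; exists x.
Qed.

Lemma In_flatten (T : Type) (ss : seq (seq T)) y :
  In y (flatten ss) <-> exists s, In s ss /\ In y s.
Proof.
elim: ss => [|a s IH] /=; first by split=> // -[x []].
rewrite Stdlib.Lists.List.in_app_iff IH; split=> [[ya|[t [ts yt]]]|[t [[<-|ts] yt]]].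
- by exists a; split; [left|].
- by exists t; split; [right|].
- by left.
- by right; exists t.
Qed.

Lemma eq_bigr_In (V : nmodType) (T : Type) (s : seq T) (F G : T -> V) :
  (forall x, In x s -> F x = G x) -> \sum_(x <- s) F x = \sum_(x <- s) G x.
Proof.
elim: s => [|a s IH] h; first by rewrite !big_nil.
by rewrite !big_cons h ?IH //=; [move=> x xs; apply: h; right | left].
Qed.

Lemma sum_neq0_In (V : nmodType) (T : Type) (s : seq T) (F : T -> V) :
  \sum_(x <- s) F x != 0 -> exists x, In x s /\ F x != 0.
Proof.
elim: s => [|a s IH]; first by rewrite big_nil eqxx.
rewrite big_cons; case: (eqVneq (F a) 0) => [->|Fa _]; last by exists a; split; [left|].
by rewrite add0r => /IH[x [xs Fx]]; exists x; split; [right|].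
Qed.

Lemma tens_suml (T : Type) (s : seq T) (F : T -> 'M[C]_2) (D : 'M[C]_2) :
  (\sum_(x <- s) F x) *t D = \sum_(x <- s) (F x *t D).
Proof.
elim: s => [|a s IH]; first by rewrite !big_nil tens0mx.
by rewrite !big_cons tensDl IH.
Qed.

Lemma tens_sumr (T : Type) (s : seq T) (F : T -> 'M[C]_2) (D : 'M[C]_2) :
  D *t (\sum_(x <- s) F x) = \sum_(x <- s) (D *t F x).
Proof.
elim: s => [|a s IH]; first by rewrite !big_nil tensmx0.
by rewrite !big_cons tensDr IH.
Qed.

Section Protocols.
Variable L : Type.
Implicit Types (P : locc C L) (ks : seq ('M[C]_2 * locc C L)).

(** Subprotocols sit inside a [seq], so the induction hypothesis ranges over the members of [ks];
    the inner inductions on [ks] keep the [fix] guarded. *)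
Lemma locc_nested_ind (Q : locc C L -> Prop) :
  (forall l, Q (Leaf l)) ->
  (forall ks, (forall kp, In kp ks -> Q kp.2) -> Q (NodeA ks)) ->
  (forall ks, (forall kp, In kp ks -> Q kp.2) -> Q (NodeB ks)) ->
  forall P, Q P.
Proof.
move=> hl ha hb; fix IH 1; case=> [l|ks|ks]; [exact: hl| apply: ha| apply: hb].
- elim: ks => [|[K P] ks IHs] kp' /=; first by case.
  by case=> [<-|]; [exact: IH | exact: IHs].
- elim: ks => [|[K P] ks IHs] kp' /=; first by case.
  by case=> [<-|]; [exact: IH | exact: IHs].
Qed.

Lemma locc_wfA ks : locc_wf (NodeA ks) <->
  \sum_(kp <- ks) (adj kp.1 *m kp.1) = 1%:M /\ (forall kp, In kp ks -> locc_wf kp.2).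
Proof.
rewrite /=; split=> -[-> h]; split=> //.
  elim: ks h => [|kp ks IH] /= => [_ ? []|[h1 h2] kp' [<-//|]]; exact: IH.
elim: ks h => [|kp ks IH] //= h; split; first by apply: h; left.
by apply: IH => kp' kp'ks; apply: h; right.
Qed.

Lemma locc_wfB ks : locc_wf (NodeB ks) <->
  \sum_(kp <- ks) (adj kp.1 *m kp.1) = 1%:M /\ (forall kp, In kp ks -> locc_wf kp.2).
Proof. exact: locc_wfA. Qed.

Lemma locc_leavesA ks : locc_leaves (NodeA ks) =
  flatten [seq [seq (Ml.1 *m (kp.1 *t 1%:M), Ml.2) | Ml <- locc_leaves kp.2] | kp <- ks].
Proof. by elim: ks => //= kp ks <-; congr (_ ++ _); apply: eq_map => -[]. Qed.

Lemma locc_leavesB ks : locc_leaves (NodeB ks) =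
  flatten [seq [seq (Ml.1 *m (1%:M *t kp.1), Ml.2) | Ml <- locc_leaves kp.2] | kp <- ks].
Proof. by elim: ks => //= kp ks <-; congr (_ ++ _); apply: eq_map => -[]. Qed.

Lemma in_leavesA ks Ml : In Ml (locc_leaves (NodeA ks)) <->
  exists kp Ml', [/\ In kp ks, In Ml' (locc_leaves kp.2) &
    (Ml'.1 *m (kp.1 *t 1%:M), Ml'.2) = Ml].
Proof.
rewrite locc_leavesA In_flatten; split=> [[s [/In_map[kp [kpks <-]] /In_map[Ml' []]]]|].
  by exists kp, Ml'.
move=> [kp [Ml' [kpks h1 h2]]]; eexists; split; apply/In_map; first by exists kp.
by exists Ml'.
Qed.

Lemma in_leavesB ks Ml : In Ml (locc_leaves (NodeB ks)) <->
  exists kp Ml', [/\ In kp ks, In Ml' (locc_leaves kp.2) &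
    (Ml'.1 *m (1%:M *t kp.1), Ml'.2) = Ml].
Proof.
rewrite locc_leavesB In_flatten; split=> [[s [/In_map[kp [kpks <-]] /In_map[Ml' []]]]|].
  by exists kp, Ml'.
move=> [kp [Ml' [kpks h1 h2]]]; eexists; split; apply/In_map; first by exists kp.
by exists Ml'.
Qed.

Lemma tens_adjl (K : 'M[C]_2) : adj (K *t 1%:M) *m (K *t 1%:M) = (adj K *m K) *t (1%:M : 'M_2).
Proof. by rewrite adj_tens (tensmx_mul (adj K)) adj_mx1 mulmx1. Qed.

Lemma tens_adjr (K : 'M[C]_2) : adj (1%:M *t K) *m (1%:M *t K) = (1%:M : 'M_2) *t (adj K *m K).
Proof. by rewrite adj_tens (tensmx_mul _ (adj K)) adj_mx1 mulmx1. Qed.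

Lemma adj_sandwich (M K : 'M[C]_(2 * 2)) :
  adj (M *m K) *m (M *m K) = adj K *m (adj M *m M) *m K.
Proof. by rewrite adjM !mulmxA. Qed.

Lemma locc_complete P : locc_wf P ->
  \sum_(Ml <- locc_leaves P) (adj Ml.1 *m Ml.1) = 1%:M.
Proof.
elim/locc_nested_ind: P => [l _|ks IH /locc_wfA[h wf]|ks IH /locc_wfB[h wf]].
- by rewrite big_seq1 adj_mx1 mulmx1.
- rewrite locc_leavesA big_flatten big_map.
  transitivity (\sum_(kp <- ks) ((adj kp.1 *m kp.1) *t (1%:M : 'M[C]_2))).
    apply: eq_bigr_In => kp kpks; rewrite big_map /=.
    under eq_bigr do rewrite adj_sandwich.
    rewrite -mulmx_suml -mulmx_sumr IH //; last exact: wf.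
    by rewrite mulmx1 tens_adjl.
  by rewrite -tens_suml h tens_scalar mul1r.
- rewrite locc_leavesB big_flatten big_map.
  transitivity (\sum_(kp <- ks) ((1%:M : 'M[C]_2) *t (adj kp.1 *m kp.1))).
    apply: eq_bigr_In => kp kpks; rewrite big_map /=.
    under eq_bigr do rewrite adj_sandwich.
    rewrite -mulmx_suml -mulmx_sumr IH //; last exact: wf.
    by rewrite mulmx1 tens_adjr.
  by rewrite -tens_sumr h tens_scalar mul1r.
Qed.

Lemma locc_ip P v w : locc_wf P ->
  ip v w = \sum_(Ml <- locc_leaves P) ip (Ml.1 *m v) (Ml.1 *m w).
Proof.
move=> /locc_complete h; under eq_bigr do rewrite ip_mulmx.
by rewrite -[w in LHS]mul1mx -h mulmx_suml /ip mulmx_sumr summxE.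
Qed.

(* The leaves of [P] with their operators kept as pairs of local factors [X], [Y],
   which [X *t Y] determines only up to a scalar. *)
Inductive fleaf : locc C L -> 'M[C]_2 -> 'M[C]_2 -> L -> Prop :=
| fleaf_leaf l : fleaf (Leaf l) 1%:M 1%:M l
| fleaf_A ks kp X Y l : In kp ks -> fleaf kp.2 X Y l -> fleaf (NodeA ks) (X *m kp.1) Y l
| fleaf_B ks kp X Y l : In kp ks -> fleaf kp.2 X Y l -> fleaf (NodeB ks) X (Y *m kp.1) l.

Lemma fleaf_in P X Y l : fleaf P X Y l -> In (X *t Y, l) (locc_leaves P).
Proof.
elim=> {P X Y l} [l|ks kp X Y l kpks _ IH|ks kp X Y l kpks _ IH].
- by left; rewrite tens_scalar mul1r.
- apply/in_leavesA; exists kp, (X *t Y, l); split=> //=.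
  by rewrite (tensmx_mul X) mulmx1.
- apply/in_leavesB; exists kp, (X *t Y, l); split=> //=.
  by rewrite (tensmx_mul X) mulmx1.
Qed.

Lemma in_fleaf P M l : In (M, l) (locc_leaves P) ->
  exists X Y, M = X *t Y /\ fleaf P X Y l.
Proof.
elim/locc_nested_ind: P M l => [l M l' [[<- <-]|//]|ks IH M l|ks IH M l].
- by exists 1%:M, 1%:M; split; [rewrite tens_scalar mul1r | constructor].
- case/in_leavesA => kp [[M' l'] /= [kpks /(IH _ kpks)[X [Y [-> h]]] [<- <-]]].
  exists (X *m kp.1), Y; split; last exact: fleaf_A.
  by rewrite (tensmx_mul X) mulmx1.
- case/in_leavesB => kp [[M' l'] /= [kpks /(IH _ kpks)[X [Y [-> h]]] [<- <-]]].
  exists X, (Y *m kp.1); split; last exact: fleaf_B.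
  by rewrite (tensmx_mul X) mulmx1.
Qed.

End Protocols.

(** * Kernels of local operators and the branches of a protocol *)

Lemma mulmx_perp (Z : 'M[C]_2) (r : 'cV[C]_2) : r != 0 -> Z *m r = 0 -> Z *m perp r = 0 -> Z = 0.
Proof.
move=> r0 h1 h2; apply: (@scalerI _ _ (ip r r)); first by rewrite ip_neq0.
by rewrite scaler0 -mul_mx_scalar -decomp_mx mulmxDr !mulmxA h1 h2 !mul0mx addr0.
Qed.

Lemma ker_par (Z : 'M[C]_2) (p r : 'cV[C]_2) : Z != 0 -> r != 0 -> Z *m p = 0 -> Z *m r = 0 ->
  exists c, p = c *: r.
Proof.
move=> Z0 r0 Zp Zr; apply: par_perp => //.
apply: contraNeq Z0 => h; apply/eqP/(mulmx_perp r0) => //.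
have /(congr1 (mulmx Z)) := ip_decomp r p.
rewrite mulmxDr -!scalemxAr Zp Zr !scaler0 add0r => /esym/eqP.
by rewrite scaler_eq0 (negbTE h) => /eqP.
Qed.

Lemma singular_ker (Z : 'M[C]_2) : Z \notin unitmx -> exists2 r : 'cV[C]_2, r != 0 & Z *m r = 0.
Proof.
rewrite -unitmx_tr unitmxE unitfE negbK => /det0P[v v0 hv].
exists v^T; first by rewrite -(inj_eq trmx_inj) trmxK trmx0.
by apply: trmx_inj; rewrite trmx_mul trmxK hv trmx0.
Qed.

Lemma unit_mul_neq0 n (Z : 'M[C]_n) (v : 'cV[C]_n) : Z \in unitmx -> v != 0 -> Z *m v != 0.
Proof. by move=> Zu; apply: contraNneq => h; rewrite -(mulKmx Zu v) h mulmx0. Qed.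

Lemma ker_rank1 (X : 'M[C]_2) (e : 'cV[C]_2) : e != 0 -> X *m perp e = 0 ->
  X = ((ip e e)^-1 *: (X *m e)) *m adj e.
Proof.
move=> e0 h; apply: (@scalerI _ _ (ip e e)); first by rewrite ip_neq0.
rewrite -scalemxAl scalerA mulfV ?ip_neq0 // scale1r.
by rewrite -mul_mx_scalar -decomp_mx mulmxDr !mulmxA h mul0mx addr0.
Qed.

Lemma rank1_perp (u e : 'cV[C]_2) : u *m adj e *m perp e = 0.
Proof. by rewrite rank1_mulmx ip_perp scale0r. Qed.

Lemma singular_rank1 (X : 'M[C]_2) : X != 0 -> X \notin unitmx ->
  exists u e : 'cV[C]_2, [/\ u != 0, e != 0 & X = u *m adj e].
Proof.
move=> X0 /singular_ker[r r0 Xr].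
have h : X *m perp (perp r) = 0 by rewrite perp_perp mulmxN Xr oppr0.
have e0 : perp r != 0 by rewrite perp_eq0.
have XE := ker_rank1 e0 h; do 2 eexists; split; [ | exact: e0 | exact: XE].
by apply: contraNneq X0 => u0; rewrite XE u0 mul0mx.
Qed.

Section Leaves.
Variable L : Type.
Implicit Types P : locc C L.

Lemma kraus_seen (ks : seq ('M[C]_2 * locc C L)) (x : 'cV[C]_2) :
  \sum_(kp <- ks) (adj kp.1 *m kp.1) = 1%:M -> x != 0 ->
  exists kp, In kp ks /\ kp.1 *m x != 0.
Proof.
move=> h x0; have: ip x x != 0 by rewrite ip_neq0.
rewrite -{2}[x]mul1mx -h mulmx_suml /ip mulmx_sumr summxE => /sum_neq0_In[kp [kpks hk]].
exists kp; split=> //; apply: contraNneq hk => hk.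
by rewrite -mulmxA hk !mulmx0 mxE.
Qed.

(** By completeness the party who measures at a node has an outcome that does not annihilate its own
    vector, and the other party's vector is untouched. Following such outcomes ends at the required
    leaf. *)
Lemma leaf_seen P (x y : 'cV[C]_2) : locc_wf P -> x != 0 -> y != 0 ->
  exists X Y l, [/\ fleaf P X Y l, X *m x != 0 & Y *m y != 0].
Proof.
elim/locc_nested_ind: P x y => [l|ks IH|ks IH] x y.
- by move=> _ x0 y0; exists 1%:M, 1%:M, l; rewrite !mul1mx; split=> //; constructor.
- move=> /locc_wfA[h wf] x0 y0; have [kp [kpks Kx]] := kraus_seen h x0.
  have [X [Y [l [h1 h2 h3]]]] := IH _ kpks _ _ (wf _ kpks) Kx y0.
  by exists (X *m kp.1), Y, l; rewrite -mulmxA; split=> //; apply: fleaf_A.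
- move=> /locc_wfB[h wf] x0 y0; have [kp [kpks Ky]] := kraus_seen h y0.
  have [X [Y [l [h1 h2 h3]]]] := IH _ kpks _ _ (wf _ kpks) x0 Ky.
  by exists X, (Y *m kp.1), l; rewrite -mulmxA; split=> //; apply: fleaf_B.
Qed.

(* On the branch to a leaf with two singular factors, consider the node where
   the first of them becomes singular: there the other party still has full
   rank, so another branch below that node shares the kernel of the first factor
   but not that of the second. *)
Lemma leaf_companion P X Y l (A B : 'M[C]_2) (p q : 'cV[C]_2) :
  fleaf P X Y l -> locc_wf P -> A \in unitmx -> B \in unitmx -> p != 0 -> q != 0 ->
  X *m A != 0 -> Y *m B != 0 -> X *m A *m p = 0 -> Y *m B *m q = 0 ->
  exists X' Y' l', fleaf P X' Y' l' /\
    ([/\ X' *m A != 0, X' *m A *m p = 0 & Y' *m B *m q != 0] \/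
     [/\ Y' *m B != 0, Y' *m B *m q = 0 & X' *m A *m p != 0]).
Proof.
move=> hl + + + p0 q0.
(* [A] and [B] accumulate the operators that Alice and Bob have applied above the current node. *)
elim: hl A B => {P X Y l} [l|ks kp X Y l kpks hl IH|ks kp X Y l kpks hl IH] A B.
- move=> _ Au _ _ _ /eqP.
  by rewrite mul1mx (negbTE (unit_mul_neq0 Au p0)).
- move=> /locc_wfA[h wf] Au Bu; have wfk := wf _ kpks; rewrite -(mulmxA X kp.1 A).
  case KAu: (kp.1 *m A \in unitmx) => X0 Y0 Xp Yq.
    have [X' [Y' [l' [hl' h']]]] := IH _ _ wfk KAu Bu X0 Y0 Xp Yq.
    by exists (X' *m kp.1), Y', l'; rewrite -(mulmxA X' kp.1 A); split=> //; apply: fleaf_A.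
  (* Here Alice's operator first becomes singular. Its kernel lies in that of the leaf's factor,
     hence is the line of [p]. Following the images of [perp p] and [q] into the subprotocol yields
     a leaf that still kills [p] but not [q]. *)
  have [r r0 KAr] := singular_ker (negbT KAu).
  have [|c pE] := ker_par X0 r0 Xp; first by rewrite -(mulmxA X) KAr mulmx0.
  have KAp : kp.1 *m A *m p = 0 by rewrite pE -scalemxAr KAr scaler0.
  have KAp' : kp.1 *m A *m perp p != 0.
    by apply: contraNneq X0 => KAp'; rewrite (mulmx_perp p0 KAp KAp') mulmx0.
  have [X' [Y' [l' [hl' X'0 Y'0]]]] := leaf_seen wfk KAp' (unit_mul_neq0 Bu q0).
  exists (X' *m kp.1), Y', l'; split; first exact: fleaf_A.
  left; rewrite -!mulmxA; split=> //; last by rewrite -mulmxA in KAp; rewrite KAp mulmx0.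
  by apply: contraNneq X'0 => X'0; rewrite mulmxA X'0 mul0mx.
- move=> /locc_wfB[h wf] Au Bu; have wfk := wf _ kpks; rewrite -(mulmxA Y kp.1 B).
  case KBu: (kp.1 *m B \in unitmx) => X0 Y0 Xp Yq.
    have [X' [Y' [l' [hl' h']]]] := IH _ _ wfk Au KBu X0 Y0 Xp Yq.
    by exists X', (Y' *m kp.1), l'; rewrite -(mulmxA Y' kp.1 B); split=> //; apply: fleaf_B.
  have [r r0 KBr] := singular_ker (negbT KBu).
  have [|c qE] := ker_par Y0 r0 Yq; first by rewrite -(mulmxA Y) KBr mulmx0.
  have KBq : kp.1 *m B *m q = 0 by rewrite qE -scalemxAr KBr scaler0.
  have KBq' : kp.1 *m B *m perp q != 0.
    by apply: contraNneq Y0 => KBq'; rewrite (mulmx_perp q0 KBq KBq') mulmx0.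
  have [X' [Y' [l' [hl' X'0 Y'0]]]] := leaf_seen wfk (unit_mul_neq0 Au p0) KBq'.
  exists X', (Y' *m kp.1), l'; split; first exact: fleaf_B.
  right; rewrite -!mulmxA; split=> //; last by rewrite -mulmxA in KBq; rewrite KBq mulmx0.
  by apply: contraNneq Y'0 => Y'0; rewrite mulmxA Y'0 mul0mx.
Qed.

End Leaves.

(** * One-way measurements built from local projectors *)

Definition kraus (e : 'cV[C]_2) : 'M[C]_2 := (ip e e)^-1 *: (e *m adj e).

Lemma kraus_complete (e : 'cV[C]_2) : e != 0 ->
  adj (kraus e) *m kraus e + adj (kraus (perp e)) *m kraus (perp e) = 1%:M.
Proof.
move=> e0; have n0 := ip_neq0 e0.
have h x : ip x x = ip e e -> adj (kraus x) *m kraus x = (ip e e)^-1 *: (x *m adj x).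
  move=> hx; rewrite /kraus adjZ adjM adjK -scalemxAr -scalemxAl mulmxA rank1_mulmx.
  rewrite -scalemxAl !scalerA rmorphV ?unitfE hx //= ip_conj.
  by rewrite -mulrA mulVf // mulr1.
by rewrite !h ?ip_perp2 // -scalerDr decomp_mx -mul_scalar_mx -scalar_mxM mulVf.
Qed.

Lemma kraus_kill (x y : 'cV[C]_2) w : ip (kron x y) w = 0 -> kraus x *t kraus y *m w = 0.
Proof.
move=> h; rewrite /kraus.
have -> a b (X Y : 'M[C]_2) : (a *: X) *t (b *: Y) = (a * b) *: (X *t Y).
  by apply/matrixP => i j; rewrite !mxE; ring.
by rewrite -scalemxAl rank1_tens rank1_mulmx h scale0r scaler0.
Qed.

Lemma kraus_pair_complete (S : Type) e (P Q : S) : e != 0 ->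
  \sum_(kp <- [:: (kraus e, P); (kraus (perp e), Q)]) (adj kp.1 *m kp.1) = 1%:M.
Proof. by move=> e0; rewrite !big_cons big_nil addr0; apply: kraus_complete. Qed.

Definition measB (f : 'cV[C]_2) : locc C unit :=
  NodeB [:: (kraus f, Leaf tt); (kraus (perp f), Leaf tt)].
Definition measA (e : 'cV[C]_2) : locc C unit :=
  NodeA [:: (kraus e, Leaf tt); (kraus (perp e), Leaf tt)].

(** Alice measures in the basis [e], [perp e]; Bob then uses the basis of [f] or that of [g],
    according to her outcome. A leaf is described only through the vectors it annihilates, which is
    all that later arguments use. *)
Lemma one_wayA (e f g : 'cV[C]_2) : e != 0 -> f != 0 -> g != 0 ->
  exists P : locc C unit, locc_wf P /\ forall Ml, In Ml (locc_leaves P) ->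
    exists x y, ((x = e /\ (y = f \/ y = perp f)) \/
                 (x = perp e /\ (y = g \/ y = perp g))) /\
      forall w, ip (kron x y) w = 0 -> Ml.1 *m w = 0.
Proof.
move=> e0 f0 g0; exists (NodeA [:: (kraus e, measB f); (kraus (perp e), measB g)]).
split; first by do !split=> //; apply: kraus_pair_complete; rewrite ?perp_eq0.
have h (x y : 'cV[C]_2) w : ip (kron x y) w = 0 ->
    1%:M *m (1%:M *t kraus y) *m (kraus x *t 1%:M) *m w = 0.
  by move=> hw; rewrite mul1mx (tensmx_mul 1%:M) mul1mx mulmx1 kraus_kill.
move=> Ml /= [|[|[|[|//]]]] <-.
- by exists e, f; split; [auto | exact: h].
- by exists e, (perp f); split; [auto | exact: h].
- by exists (perp e), g; split; [auto | exact: h].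
- by exists (perp e), (perp g); split; [auto | exact: h].
Qed.

Lemma one_wayB (f e g : 'cV[C]_2) : f != 0 -> e != 0 -> g != 0 ->
  exists P : locc C unit, locc_wf P /\ forall Ml, In Ml (locc_leaves P) ->
    exists x y, ((y = f /\ (x = e \/ x = perp e)) \/
                 (y = perp f /\ (x = g \/ x = perp g))) /\
      forall w, ip (kron x y) w = 0 -> Ml.1 *m w = 0.
Proof.
move=> f0 e0 g0; exists (NodeB [:: (kraus f, measA e); (kraus (perp f), measA g)]).
split; first by do !split=> //; apply: kraus_pair_complete; rewrite ?perp_eq0.
have h (x y : 'cV[C]_2) w : ip (kron x y) w = 0 ->
    1%:M *m (kraus x *t 1%:M) *m (1%:M *t kraus y) *m w = 0.
  by move=> hw; rewrite mul1mx (tensmx_mul _ 1%:M 1%:M) mul1mx mulmx1 kraus_kill.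
move=> Ml /= [|[|[|[|//]]]] <-.
- by exists e, f; split; [auto | exact: h].
- by exists (perp e), f; split; [auto | exact: h].
- by exists g, (perp f); split; [auto | exact: h].
- by exists (perp g), (perp f); split; [auto | exact: h].
Qed.

(** * Survivors of an outcome *)

(** If [f'] had a component along [perp f], then [w] would also be orthogonal to [kron e (perp f)],
    which [entangled_left] excludes. *)
Lemma entangled_left' (e f f' : 'cV[C]_2) w : e != 0 -> f != 0 -> entangled w ->
  ip (kron e f) w = 0 -> ip (kron e f') w = 0 -> ip (perp f) f' = 0.
Proof.
move=> e0 f0 went h1 h2; apply/eqP; apply: contraT => hf; exfalso.
apply: (entangled_left e0 f0 went h1).
have := congr1 (fun g => ip (kron e g) w) (ip_decomp f f').
rewrite kronDr !kronZr ipDl !ipZl h1 h2 !mulr0 add0r => /esym/eqP.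
by rewrite mulf_eq0 conjC_eq0 (negbTE hf) => /eqP.
Qed.

Lemma entangled_right' (e e' f : 'cV[C]_2) w : e != 0 -> f != 0 -> entangled w ->
  ip (kron e f) w = 0 -> ip (kron e' f) w = 0 -> ip (perp e) e' = 0.
Proof.
move=> e0 f0 went h1 h2; apply/eqP; apply: contraT => hf; exfalso.
apply: (entangled_right e0 f0 went h1).
have := congr1 (fun g => ip (kron g f) w) (ip_decomp e e').
rewrite kronDl !kronZl ipDl !ipZl h1 h2 !mulr0 add0r => /esym/eqP.
by rewrite mulf_eq0 conjC_eq0 (negbTE hf) => /eqP.
Qed.

Lemma ip_tens_kron (X Y : 'M[C]_2) (x y : 'cV[C]_2) w :
  ip (kron x y) (X *t Y *m w) = ip (kron (adj X *m x) (adj Y *m y)) w.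
Proof. by rewrite -tens_kron -adj_tens ip_adjl adjK. Qed.

Lemma adj_eq0 m n (X : 'M[C]_(m, n)) : (adj X == 0) = (X == 0).
Proof.
apply/eqP/eqP => [h|->]; last by apply/matrixP => i j; rewrite adjE !mxE conjC0.
by rewrite -[X]adjK h; apply/matrixP => i j; rewrite adjE !mxE conjC0.
Qed.

Lemma delta_neq0 : (delta_mx 0 0 : 'cV[C]_2) != 0.
Proof. by apply/eqP => /matrixP/(_ 0 0)/eqP; rewrite !mxE /= oner_eq0. Qed.

Lemma mulmx_neq0 (Z : 'M[C]_2) : Z != 0 -> exists g : 'cV[C]_2, Z *m g != 0.
Proof.
move=> Z0; have d0 := delta_neq0.
case: (eqVneq (Z *m (delta_mx 0 0 : 'cV_2)) 0) => [h|]; last by exists (delta_mx 0 0).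
exists (perp (delta_mx 0 0)); apply: contraNneq Z0 => h'.
by rewrite (mulmx_perp d0 h h').
Qed.

Lemma unit_adj (X : 'M[C]_2) : X \in unitmx -> adj X \in unitmx.
Proof. by rewrite /adj unitmx_tr map_unitmx. Qed.

(** With [X] invertible, [adj X] reaches every vector of Alice, so an annihilated [w] would be
    orthogonal to all products with one fixed vector of Bob. Hence an outcome that eliminates an
    entangled state has two singular factors. *)
Lemma kill_unitl (X Y : 'M[C]_2) w : X \in unitmx -> Y != 0 -> entangled w ->
  X *t Y *m w != 0.
Proof.
move=> Xu Y0 went; apply/eqP => h.
have [g] : exists g : 'cV[C]_2, adj Y *m g != 0 by apply: mulmx_neq0; rewrite adj_eq0.
move=> f0; have e0 := delta_neq0.
have hk x : ip (kron x (adj Y *m g)) w = 0.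
  rewrite -[x](mulKVmx (unit_adj Xu)).
  by rewrite -ip_tens_kron h ip0r.
exact: (entangled_right e0 f0 went (hk _) (hk _)).
Qed.

Lemma kill_unitr (X Y : 'M[C]_2) w : X != 0 -> Y \in unitmx -> entangled w ->
  X *t Y *m w != 0.
Proof.
move=> X0 Yu went; apply/eqP => h.
have [g] : exists g : 'cV[C]_2, adj X *m g != 0 by apply: mulmx_neq0; rewrite adj_eq0.
move=> e0; have f0 := delta_neq0.
have hk x : ip (kron (adj X *m g) x) w = 0.
  rewrite -[x](mulKVmx (unit_adj Yu)).
  by rewrite -ip_tens_kron h ip0r.
exact: (entangled_left e0 f0 went (hk _) (hk _)).
Qed.

Lemma adj_rank1 m n (u : 'cV[C]_m) (e : 'cV[C]_n) x : adj (u *m adj e) *m x = ip u x *: e.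
Proof. by rewrite adjM adjK rank1_mulmx. Qed.

(** Two outcomes that share Alice's vector [e] and eliminate the same entangled state must also
    agree in Bob's direction. Contraposed, a companion whose [Y] does not vanish on [perp f]
    eliminates none of the entangled states that [kron e f] eliminates. *)
Lemma kill_left (u e f : 'cV[C]_2) (Y : 'M[C]_2) w :
  u != 0 -> e != 0 -> f != 0 -> entangled w ->
  ip (kron e f) w = 0 -> (u *m adj e) *t Y *m w = 0 -> Y *m perp f = 0.
Proof.
move=> u0 e0 f0 went h1 h2; apply/eqP; rewrite -ip_eq0 ip_adjl.
apply/eqP/(entangled_left' e0 f0 went h1).
have := ip_tens_kron (u *m adj e) Y u (Y *m perp f) w.
rewrite h2 ip0r adj_rank1 kronZl ipZl => /esym/eqP.
by rewrite mulf_eq0 conjC_eq0 (negbTE (ip_neq0 u0)) => /eqP.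
Qed.

Lemma kill_right (v e f : 'cV[C]_2) (X : 'M[C]_2) w :
  v != 0 -> e != 0 -> f != 0 -> entangled w ->
  ip (kron e f) w = 0 -> X *t (v *m adj f) *m w = 0 -> X *m perp e = 0.
Proof.
move=> v0 e0 f0 went h1 h2; apply/eqP; rewrite -ip_eq0 ip_adjl.
apply/eqP/(entangled_right' e0 f0 went h1).
have := ip_tens_kron X (v *m adj f) (X *m perp e) v w.
rewrite h2 ip0r adj_rank1 kronZr ipZl => /esym/eqP.
by rewrite mulf_eq0 conjC_eq0 (negbTE (ip_neq0 v0)) => /eqP.
Qed.

Lemma complementary_pairs (A B : {set 'I_4}) :
  (#|A| <= 2)%N -> (#|B| <= 2)%N -> (forall k, (k \in A) || (k \in B)) ->
  #|A| = 2%N /\ B = ~: A.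
Proof.
move=> hA hB hAB; have AB : ~: A \subset B.
  by apply/subsetP => k; rewrite inE; have := hAB k; case: (k \in A).
have := cardsC A; rewrite card_ord => hC.
have le := subset_leq_card AB.
have arith (a b c : nat) : (a <= 2 -> b <= 2 -> a + c = 4 -> c <= b -> a = 2 /\ b <= c)%N.
  by lia.
have [A2 BA] := arith _ _ _ hA hB hC le.
by split=> //; apply/esym/eqP; rewrite eqEcard AB BA.
Qed.

Section Survivors.
Variable psi : 'I_4 -> 'cV[C]_(2 * 2).
Hypothesis psi_on : orthonormal4 psi.

Definition surv (M : 'M[C]_(2 * 2)) : {set 'I_4} := [set k | M *m psi k != 0].
Definition psurv (e f : 'cV[C]_2) : {set 'I_4} := [set k | ip (kron e f) (psi k) != 0].

Lemma surv_rank1 u e v f : u != 0 -> v != 0 ->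
  surv ((u *m adj e) *t (v *m adj f)) = psurv e f.
Proof.
move=> u0 v0; apply/setP => k; rewrite !inE rank1_tens rank1_mulmx scaler_eq0.
by rewrite kron_eq0 (negbTE u0) (negbTE v0) /= orbF.
Qed.

Lemma psurvZl c e f : c != 0 -> psurv (c *: e) f = psurv e f.
Proof.
move=> c0; apply/setP => k; rewrite !inE kronZl ipZl mulf_eq0 conjC_eq0.
by rewrite (negbTE c0).
Qed.

Lemma psurvZr c e f : c != 0 -> psurv e (c *: f) = psurv e f.
Proof.
move=> c0; apply/setP => k; rewrite !inE kronZr ipZl mulf_eq0 conjC_eq0.
by rewrite (negbTE c0).
Qed.

(** In the Parseval sum every index contributes zero, since each state is missed by one of the two
    product vectors. The vectors are therefore orthogonal, and being products they are orthogonal on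
    one side. *)
Lemma psurv_disjoint e f e' f' : psurv e' f' = ~: psurv e f -> ip e e' * ip f f' = 0.
Proof.
move=> /setP h; rewrite -ip_kron (parseval psi_on) big1 // => k _.
have := h k; rewrite !inE; case: (eqVneq (ip (kron e f) (psi k)) 0) => [->|_].
  by rewrite mul0r.
by move/negbFE; rewrite ip_sym0 => /eqP->; rewrite mulr0.
Qed.

Variable i0 : 'I_4.
Hypothesis psi_ent : forall k, k != i0 -> entangled (psi k).

Section Stop.
Variables (L : Type) (P : locc C L).
Hypothesis P_wf : locc_wf P.
Hypothesis surv_le2 : forall Ml, In Ml (locc_leaves P) -> (#|surv Ml.1| <= 2)%N.

(** Survival of [i0] makes every eliminated state entangled. By [kill_left] or [kill_right] the leaf
    and its companion then eliminate no common state, so two sets of at most two survivors cover all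
    four indices and are complementary. *)
Lemma stop Ml : In Ml (locc_leaves P) -> i0 \in surv Ml.1 ->
  [/\ #|surv Ml.1| = 2%N,
      exists Ml', In Ml' (locc_leaves P) /\ surv Ml'.1 = ~: surv Ml.1 &
      exists u e v f, [/\ [/\ u != 0, e != 0, v != 0 & f != 0],
        Ml.1 = (u *m adj e) *t (v *m adj f) &
        psurv e (perp f) = ~: psurv e f \/ psurv (perp e) f = ~: psurv e f]].
Proof.
case: Ml => M l hM /= hi0; have le2 := surv_le2 hM.
have [X [Y [ME hl]]] := in_fleaf hM.
have M0 : M != 0 by apply: contraTneq hi0 => ->; rewrite inE mul0mx eqxx.
have X0 : X != 0 by apply: contraNneq M0 => X0; rewrite ME X0 tens0mx.
have Y0 : Y != 0 by apply: contraNneq M0 => Y0; rewrite ME Y0 tensmx0.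
(* At least two of the four states are eliminated, and at most one of these is [i0]. *)
have killed_ent N : (#|surv N| <= 2)%N ->
    exists k, [/\ k != i0, entangled (psi k) & N *m psi k = 0].
  move=> N2; have : (1 < #|~: surv N|)%N.
    have := cardsC (surv N); rewrite card_ord.
    have arith (a b : nat) : (a <= 2 -> a + b = 4 -> 1 < b)%N by lia.
    exact: arith N2.
  case/card_gt1P => a [b [ha hb ab]].
  have [k [hk ki]] : exists k, k \in ~: surv N /\ k != i0.
    by case: (eqVneq a i0) => [ai|ai]; [exists b; rewrite -ai eq_sym | exists a].
  exists k; split=> //; first exact: psi_ent.
  by move: hk; rewrite !inE negbK => /eqP.
have sing (Z W : 'M[C]_2) : Z != 0 -> W != 0 -> (#|surv (Z *t W)| <= 2)%N ->
    Z \notin unitmx /\ W \notin unitmx.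
  move=> Z0 W0 /killed_ent[k [_ kent /eqP hk]].
  by split; apply: contraL hk => ?; [apply: kill_unitl | apply: kill_unitr].
have [|Xs Ys] := sing X Y X0 Y0; first by rewrite -ME.
have [u [e [u0 e0 XE]]] := singular_rank1 X0 Xs.
have [v [f [v0 f0 YE]]] := singular_rank1 Y0 Ys.
have SM : surv M = psurv e f by rewrite ME XE YE surv_rank1.
have Kill k : k \notin psurv e f -> entangled (psi k) /\ ip (kron e f) (psi k) = 0.
  rewrite inE negbK => /eqP h; split=> //; apply: psi_ent.
  by apply: contraTneq hi0 => <-; rewrite SM inE h eqxx.
have [||||||||X' [Y' [l' [hl']]]] :=
  leaf_companion (A := 1%:M) (B := 1%:M) (p := perp e) (q := perp f) hl P_wf.
- by rewrite unitmx1.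
- by rewrite unitmx1.
- by rewrite perp_eq0.
- by rewrite perp_eq0.
- by rewrite mulmx1.
- by rewrite mulmx1.
- by rewrite mulmx1 XE rank1_perp.
- by rewrite mulmx1 YE rank1_perp.
rewrite !mulmx1; have hM' := fleaf_in hl'; have le2' := surv_le2 hM'; rewrite /= in le2'.
case=> [[X'0 X'p Y'q]|[Y'0 Y'q X'p]].
- have Y'0 : Y' != 0 by apply: contraNneq Y'q => ->; rewrite mul0mx.
  have [_ Y's] := sing _ _ X'0 Y'0 le2'.
  have [v' [f' [v'0 f'0 Y'E]]] := singular_rank1 Y'0 Y's.
  have X'E := ker_rank1 e0 X'p; set u' := _ *: _ in X'E.
  have u'0 : u' != 0 by apply: contraNneq X'0 => h; rewrite X'E h mul0mx.
  have [|M2 M'E] := complementary_pairs le2 le2'.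
    move=> k; apply: contraT; rewrite negb_or SM => /andP[/Kill[kent h1]].
    rewrite inE negbK => /eqP h2; move: Y'q; rewrite X'E in h2.
    by rewrite (kill_left u'0 e0 f0 kent h1 h2) eqxx.
  split=> //; first by exists (X' *t Y', l').
  exists u, e, v, f; split=> //; first by rewrite ME XE YE.
  (* Complementary survivors make [kron e f] and [kron e f'] orthogonal, so [f'] is a multiple of
     [perp f], and rescaling does not change the survivors. *)
  left; have S' : psurv e f' = ~: psurv e f by rewrite -SM -M'E X'E Y'E surv_rank1.
  rewrite -S'; have /eqP := psurv_disjoint S'.
  rewrite mulf_eq0 (negbTE (ip_neq0 e0)) => /eqP/(perp_par f0)[c f'E].
  by rewrite f'E psurvZr // (par_neq0 f'0 f'E).
- have X'0 : X' != 0 by apply: contraNneq X'p => ->; rewrite mul0mx.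
  have [X's _] := sing _ _ X'0 Y'0 le2'.
  have [u' [e' [u'0 e'0 X'E]]] := singular_rank1 X'0 X's.
  have Y'E := ker_rank1 f0 Y'q; set v' := _ *: _ in Y'E.
  have v'0 : v' != 0 by apply: contraNneq Y'0 => h; rewrite Y'E h mul0mx.
  have [|M2 M'E] := complementary_pairs le2 le2'.
    move=> k; apply: contraT; rewrite negb_or SM => /andP[/Kill[kent h1]].
    rewrite inE negbK => /eqP h2; move: X'p; rewrite Y'E in h2.
    by rewrite (kill_right v'0 e0 f0 kent h1 h2) eqxx.
  split=> //; first by exists (X' *t Y', l').
  exists u, e, v, f; split=> //; first by rewrite ME XE YE.
  right; have S' : psurv e' f = ~: psurv e f by rewrite -SM -M'E X'E Y'E surv_rank1.
  rewrite -S'; have /eqP := psurv_disjoint S'.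
  rewrite mulf_eq0 (negbTE (ip_neq0 f0)) orbF => /eqP/(perp_par e0)[c e'E].
  by rewrite e'E psurvZl // (par_neq0 e'0 e'E).
Qed.

End Stop.
End Survivors.

Lemma ip_perp_eq0 (v w : 'cV[C]_2) : (ip v (perp w) == 0) = (ip (perp v) w == 0).
Proof. by rewrite ip_perp_flip oppr_eq0 conjC_eq0. Qed.

Lemma not_par_perp (v w : 'cV[C]_2) : v != 0 -> w != 0 -> ip v w = 0 -> ip (perp v) w != 0.
Proof.
move=> v0 w0 h1; apply: contraNneq w0 => h2; have /eqP := ip_decomp v w.
by rewrite h1 h2 !scale0r addr0 scaler_eq0 (negbTE (ip_neq0 v0)).
Qed.

Lemma psumr_In_eq0 (T : Type) (s : seq T) (F : T -> C) :
  (forall x, In x s -> 0 <= F x) -> \sum_(x <- s) F x = 0 -> forall x, In x s -> F x = 0.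
Proof.
elim: s => [|a s IH] // h; rewrite big_cons => /eqP.
have hs x : In x s -> 0 <= F x by move=> xs; apply: h; right.
have s0 : 0 <= \sum_(x <- s) F x.
  elim: s hs {IH h} => [|b s IH] hs; first by rewrite big_nil.
  by rewrite big_cons addr_ge0 ?IH //; [apply: hs; left | move=> x xs; apply: hs; right].
rewrite paddr_eq0 //; last by apply: h; left.
by case/andP=> /eqP Fa /eqP Fs x [<-//|]; apply: IH.
Qed.

Lemma has_In (T : Type) (a : pred T) s : reflect (exists x, In x s /\ a x) (has a s).
Proof.
elim: s => [|y s IH] /=; first by constructor; case=> x [].
apply: (iffP orP) => [[ay|/IH[x [xs ax]]]|[x [[->|xs] ax]]].
- by exists y; split; [left|].
- by exists x; split; [right|].
- by left.
- by right; apply/IH; exists x.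
Qed.

(** * Completing two outcomes to a separating product basis *)

Section Geometry.
Variable psi : 'I_4 -> 'cV[C]_(2 * 2).
Hypothesis psi_on : orthonormal4 psi.
Local Notation psurv := (psurv psi).
Local Notation surv := (surv psi).
Implicit Types (e f g : 'cV[C]_2) (G : {set 'I_4}).

Lemma separates_of_leaves (P : locc C unit) G : locc_wf P ->
  (forall Ml, In Ml (locc_leaves P) -> exists x y,
     ((psurv x y \subset G) || (psurv x y \subset ~: G)) /\
     forall w, ip (kron x y) w = 0 -> Ml.1 *m w = 0) ->
  locc_separates_group psi G.
Proof.
move=> wf h; exists P; split=> // Ml /h[x [y [/orP[]/subsetP hs hk]]]; [left|right] => k kG.
all: apply: hk; apply/eqP; apply: contraT => hne.
- by have := hs k; rewrite inE hne (negbTE kG) => /(_ isT).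
- by have := hs k; rewrite !inE hne kG => /(_ isT).
Qed.

Lemma separatesA e f g G : e != 0 -> f != 0 -> g != 0 ->
  (psurv e f \subset G) || (psurv e f \subset ~: G) ->
  (psurv e (perp f) \subset G) || (psurv e (perp f) \subset ~: G) ->
  (psurv (perp e) g \subset G) || (psurv (perp e) g \subset ~: G) ->
  (psurv (perp e) (perp g) \subset G) || (psurv (perp e) (perp g) \subset ~: G) ->
  locc_separates_group psi G.
Proof.
move=> e0 f0 g0 h1 h2 h3 h4; have [P [wf hP]] := one_wayA e0 f0 g0.
apply: (separates_of_leaves wf) => Ml /hP[x [y [hxy hk]]].
by exists x, y; split; [case: hxy => -[-> [] ->] | exact: hk].
Qed.

Lemma separatesB f e g G : f != 0 -> e != 0 -> g != 0 ->
  (psurv e f \subset G) || (psurv e f \subset ~: G) ->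
  (psurv (perp e) f \subset G) || (psurv (perp e) f \subset ~: G) ->
  (psurv g (perp f) \subset G) || (psurv g (perp f) \subset ~: G) ->
  (psurv (perp g) (perp f) \subset G) || (psurv (perp g) (perp f) \subset ~: G) ->
  locc_separates_group psi G.
Proof.
move=> f0 e0 g0 h1 h2 h3 h4; have [P [wf hP]] := one_wayB f0 e0 g0.
apply: (separates_of_leaves wf) => Ml /hP[x [y [hxy hk]]].
by exists x, y; split; [case: hxy => -[-> [] ->] | exact: hk].
Qed.

Variable i0 : 'I_4.
Hypothesis psi_ent : forall k, k != i0 -> entangled (psi k).
Variable G : {set 'I_4}.
Hypothesis i0G : i0 \in G.
Hypothesis G2 : #|G| = 2%N.

Lemma outside : exists2 k, k \notin G & entangled (psi k).
Proof.
have : (0 < #|~: G|)%N by have := cardsC G; rewrite card_ord G2; case: #|_|.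
case/card_gt0P => k; rewrite inE => kG; exists k => //; apply: psi_ent.
by apply: contraNneq kG => ->.
Qed.

Lemma psurv_kill e f k : psurv e f = G -> k \notin G -> ip (kron e f) (psi k) = 0.
Proof. by move=> <-; rewrite inE negbK => /eqP. Qed.

Lemma psurv_killC e f k : psurv e f = ~: G -> k \in G -> ip (kron e f) (psi k) = 0.
Proof.
by move/setP/(_ k) => h kG; move: h; rewrite !inE kG => /negbFE/eqP.
Qed.

(** Expand [psi i], with [i] in [G], in the product basis and pair it with an entangled [psi k]
    outside [G]. The three known corners contribute zero, so the product of the two amplitudes at
    the fourth corner is zero. The amplitude of [psi k] cannot vanish, by [entangled_right]. *)
Lemma fourth_corner e f : e != 0 -> f != 0 -> psurv e f = G ->
  psurv e (perp f) = ~: G -> psurv (perp e) (perp f) = G -> psurv (perp e) f \subset ~: G.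
Proof.
move=> e0 f0 h1 h2 h3; have [k kG kent] := outside.
apply/subsetP => i; rewrite !inE; apply: contraNN => iG; apply/eqP.
have := congr1 (ip (psi k)) (kron_decomp e f (psi i)).
rewrite !ipDr !ipZr ip_psi // (psurv_killC h2 iG) mul0r addr0.
rewrite -[ip (psi k) (kron e f)]ip_conj (psurv_kill h1 kG).
rewrite -[ip (psi k) (kron (perp e) (perp f))]ip_conj (psurv_kill h3 kG) conjC0 !mulr0.
rewrite (_ : k == i = false); last by apply: contraNF kG => /eqP->.
rewrite mulr0 add0r addr0 => /esym/eqP; rewrite mulf_eq0 => /orP[/eqP//|].
rewrite ip_sym0 => /eqP h4.
by case: (entangled_right e0 f0 kent (psurv_kill h1 kG) h4).
Qed.

(** Orthogonality of each outcome to the other one's companion leaves two possibilities: both local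
    vectors are parallel, which is excluded, or both are orthogonal. In the second case three
    corners of the basis built from [e] and [f] are known and [fourth_corner] supplies the last. *)
Lemma stops_mixed e f e' f' : e != 0 -> f != 0 -> e' != 0 -> f' != 0 ->
  psurv e f = G -> psurv e' f' = G ->
  psurv e (perp f) = ~: G -> psurv (perp e') f' = ~: G ->
  ~~ ((ip (perp e) e' == 0) && (ip (perp f) f' == 0)) -> locc_separates_group psi G.
Proof.
move=> e0 f0 e'0 f'0 h h' hA hB.
have d1 : (ip (perp e) e' == 0) || (ip f f' == 0).
  by rewrite -ip_perp_eq0 -mulf_eq0; apply/eqP/(psurv_disjoint psi_on); rewrite h.
have d2 : (ip e e' == 0) || (ip (perp f) f' == 0).
  rewrite ip_sym0 [X in _ || X]ip_sym0 -mulf_eq0.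
  by apply/eqP/(psurv_disjoint psi_on); rewrite h'.
case: eqP d1 d2 => [ee' _|_ /= /eqP ff'].
  case: eqP => [ee _|_ /= ->//].
  by have := not_par_perp e0 e'0 ee; rewrite ee' eqxx.
rewrite (negbTE (not_par_perp f0 f'0 ff')) orbF => /eqP ee' _.
have [c e'E] := perp_par e0 ee'; have [d f'E] := perp_par f0 ff'.
have h'' : psurv (perp e) (perp f) = G.
  by rewrite -h' e'E f'E psurvZl ?psurvZr ?(par_neq0 e'0 e'E) ?(par_neq0 f'0 f'E).
apply: (separatesA e0 f0 f0); rewrite ?h ?hA ?h'' ?subxx ?orbT //.
by rewrite (fourth_corner e0 f0 h hA h'') orbT.
Qed.

(** The cases record which party's vector each companion shares. When both share the same party's
    vector, either these shared vectors are orthogonal and the four outcomes form a one-way basis,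
    or the vectors of the other party are parallel. An entangled state outside [G] then makes the
    shared vectors parallel too, against the last hypothesis. *)
Lemma two_stops e f e' f' : e != 0 -> f != 0 -> e' != 0 -> f' != 0 ->
  psurv e f = G -> psurv e' f' = G ->
  psurv e (perp f) = ~: G \/ psurv (perp e) f = ~: G ->
  psurv e' (perp f') = ~: G \/ psurv (perp e') f' = ~: G ->
  ~~ ((ip (perp e) e' == 0) && (ip (perp f) f' == 0)) -> locc_separates_group psi G.
Proof.
move=> e0 f0 e'0 f'0 h h' [hA|hB] [hA'|hB'] np.
- have /eqP : ip e e' * ip f (perp f') = 0 by apply: (psurv_disjoint psi_on); rewrite h.
  rewrite mulf_eq0 => /orP[/eqP ee'|ff'].
    have [c e'E] := perp_par e0 ee'; have c0 := par_neq0 e'0 e'E.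
    move: h' hA'; rewrite e'E !psurvZl // => h' hA'.
    by apply: (separatesA e0 f0 f'0); rewrite ?h ?hA ?h' ?hA' subxx ?orbT.
  move: (ff'); rewrite ip_sym0 => /eqP/(par_perp f'0)[c fE].
  move: h; rewrite fE psurvZr ?(par_neq0 f0 fE) // => h.
  have [k kG kent] := outside.
  have ee := entangled_right' e0 f'0 kent (psurv_kill h kG) (psurv_kill h' kG).
  by move: np; rewrite ee eqxx -ip_perp_eq0 ff'.
- exact: (stops_mixed e0 f0 e'0 f'0).
- apply: (stops_mixed e'0 f'0 e0 f0 h' h hA' hB).
  by rewrite -!ip_perp_eq0 ip_sym0 [X in _ && X]ip_sym0.
- have /eqP : ip e (perp e') * ip f f' = 0 by apply: (psurv_disjoint psi_on); rewrite h.
  rewrite mulf_eq0 => /orP[ee'|/eqP ff']; last first.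
    have [c f'E] := perp_par f0 ff'; have c0 := par_neq0 f'0 f'E.
    move: h' hB'; rewrite f'E !psurvZr // => h' hB'.
    by apply: (separatesB f0 e0 e'0); rewrite ?h ?hB ?h' ?hB' subxx ?orbT.
  move: (ee'); rewrite ip_sym0 => /eqP/(par_perp e'0)[c eE].
  move: h; rewrite eE psurvZl ?(par_neq0 e0 eE) // => h.
  have [k kG kent] := outside.
  have ff := entangled_left' e'0 f0 kent (psurv_kill h kG) (psurv_kill h' kG).
  by move: np; rewrite ff eqxx -ip_perp_eq0 ee'.
Qed.

End Geometry.

(** * A separated pair from outcomes with at most two survivors *)

Section Core.
Variable psi : 'I_4 -> 'cV[C]_(2 * 2).
Hypothesis psi_on : orthonormal4 psi.
Variable i0 : 'I_4.
Hypothesis psi_ent : forall k, k != i0 -> entangled (psi k).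
Variables (L : Type) (P : locc C L).
Hypothesis P_wf : locc_wf P.
Hypothesis surv_le2 :
  forall Ml, In Ml (locc_leaves P) -> (#|surv psi Ml.1| <= 2)%N.

Lemma leaf_survives i : exists Ml, In Ml (locc_leaves P) /\ i \in surv psi Ml.1.
Proof.
have: ip (psi i) (psi i) != 0 by rewrite ip_psi // eqxx oner_eq0.
rewrite (locc_ip _ _ P_wf) => /sum_neq0_In[Ml [hMl h]]; exists Ml; split=> //.
by rewrite inE -ip_eq0.
Qed.

Lemma complementary_leaves : exists Ml Ml',
  [/\ In Ml (locc_leaves P), In Ml' (locc_leaves P) & surv psi Ml'.1 = ~: surv psi Ml.1].
Proof.
have [Ml [hMl hi]] := leaf_survives i0.
have [_ [Ml' [hMl' E]] _] := stop psi_on psi_ent P_wf surv_le2 hMl hi.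
by exists Ml, Ml'.
Qed.

(** Otherwise every leaf where both states survive kills [psi i0 - t *: psi j], so each leaf
    contributes a nonnegative term to [t^*] times the inner product of [psi j] and [psi i0]. That
    total is zero, so the term at [Ml] vanishes. This forces [t = 0], and then [Ml] would kill
    [psi i0]. *)
Lemma second_leaf Ml j t : In Ml (locc_leaves P) ->
  i0 \in surv psi Ml.1 -> j \in surv psi Ml.1 -> j != i0 ->
  Ml.1 *m (psi i0 - t *: psi j) = 0 ->
  exists Nl, [/\ In Nl (locc_leaves P), i0 \in surv psi Nl.1, j \in surv psi Nl.1 &
                 Nl.1 *m (psi i0 - t *: psi j) != 0].
Proof.
move=> hMl hi hj ji hM.
pose a (Nl : 'M[C]_(2 * 2) * L) := [&& i0 \in surv psi Nl.1, j \in surv psi Nl.1 &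
  Nl.1 *m (psi i0 - t *: psi j) != 0].
case: (has_In a (locc_leaves P)) => [[Nl [hNl /and3P[h1 h2 h3]]]|hno]; first by exists Nl.
have hE (N : 'M[C]_(2 * 2)) : N *m (psi i0 - t *: psi j) = 0 ->
    t^* * ip (N *m psi j) (N *m psi i0) = t^* * t * ip (N *m psi j) (N *m psi j).
  rewrite mulmxBr -scalemxAr => /eqP; rewrite subr_eq0 => /eqP ->.
  by rewrite ipZr mulrA.
have hge Nl : In Nl (locc_leaves P) -> 0 <= t^* * ip (Nl.1 *m psi j) (Nl.1 *m psi i0).
  move=> hNl; case: (boolP (i0 \in surv psi Nl.1)) => [h1|]; last first.
    by rewrite inE negbK => /eqP ->; rewrite ip0r mulr0.
  case: (boolP (j \in surv psi Nl.1)) => [h2|]; last first.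
    by rewrite inE negbK => /eqP ->; rewrite -ip_conj ip0r conjC0 mulr0.
  rewrite hE; first by rewrite mulr_ge0 ?ip_ge0 // mulrC mul_conjC_ge0.
  apply/eqP; apply: contraT => h3; exfalso; apply: hno; exists Nl; split=> //.
  by rewrite /a h1 h2 h3.
have := psumr_In_eq0 hge; rewrite -mulr_sumr -locc_ip // ip_psi // (negbTE ji) mulr0.
move=> /(_ erefl _ hMl)/eqP; rewrite hE // mulf_eq0 mulrC mul_conjC_eq0.
move: hi hj; rewrite !inE => hi hj; rewrite ip_eq0 (negbTE hj) orbF => /eqP t0.
by move: hM hi; rewrite t0 scale0r subr0 => ->; rewrite eqxx.
Qed.

Lemma core : exists G : {set 'I_4}, #|G| = 2%N /\ locc_separates_group psi G.
Proof.
have [Ml [hMl hi]] := leaf_survives i0.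
have [G2 _ [u [e [v [f [[u0 e0 v0 f0] ME hS]]]]]] :=
  stop psi_on psi_ent P_wf surv_le2 hMl hi.
have SM : surv psi Ml.1 = psurv psi e f by rewrite ME surv_rank1.
have [j [hj ji]] : exists j, j \in surv psi Ml.1 /\ j != i0.
  have : (1 < #|surv psi Ml.1|)%N by rewrite G2.
  case/card_gt1P => a [b [ha hb ab]].
  by case: (eqVneq a i0) => [ai|ai]; [exists b; rewrite -ai eq_sym | exists a].
have GE : surv psi Ml.1 = [set i0; j].
  apply/esym/eqP; rewrite eqEcard G2 cards2 eq_sym ji andbT.
  by apply/subsetP => k; rewrite !inE => /orP[]/eqP->; [move: hi|move: hj]; rewrite inE.
(* With this [t] the combination is orthogonal to [kron e f], hence to every parallel product
   vector; an outcome that does not kill it is therefore not parallel to the first. *)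
pose t := ip (kron e f) (psi i0) / ip (kron e f) (psi j).
have ef0 : ip (kron e f) (psi i0 - t *: psi j) = 0.
  rewrite ipBr ipZr mulfVK ?subrr //.
  by move: hj; rewrite SM inE.
have [|Nl [hNl hNi hNj hN]] := second_leaf (t := t) hMl hi hj ji.
  by rewrite ME rank1_tens rank1_mulmx ef0 scale0r.
have [G2' _ [u' [e' [v' [f' [[u'0 e'0 v'0 f'0] NE hS']]]]]] :=
  stop psi_on psi_ent P_wf surv_le2 hNl hNi.
have SN : surv psi Nl.1 = psurv psi e' f' by rewrite NE surv_rank1.
have GE' : surv psi Nl.1 = [set i0; j].
  apply/esym/eqP; rewrite eqEcard G2' cards2 eq_sym ji andbT.
  by apply/subsetP => k; rewrite !inE => /orP[]/eqP->; [move: hNi|move: hNj]; rewrite inE.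
exists [set i0; j]; rewrite -{1}GE; split=> //.
rewrite -SM GE in hS; rewrite -SN GE' in hS'.
apply: (two_stops psi_on psi_ent (G := [set i0; j]) _ _ e0 f0 e'0 f'0) => //.
- by rewrite !inE eqxx.
- by rewrite -GE.
- by rewrite -SM.
- by rewrite -SN.
apply: contraNN hN => /andP[/eqP ee' /eqP ff'].
have [c e'E] := par_perp e0 ee'; have [d f'E] := par_perp f0 ff'.
rewrite NE rank1_tens rank1_mulmx e'E f'E kronZl kronZr !ipZl ef0 !mulr0.
by rewrite scale0r.
Qed.

End Core.

(** * Separable operators *)

Lemma psd2_adjM (X : 'M[C]_2) : psd2 (adj X *m X).
Proof.
split=> [|v]; first by rewrite adjM adjK.
by have := ip_ge0 (X *m v); rewrite ip_mulmx /ip mulmxA.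
Qed.

Lemma separable0 : separable (0 : 'M[C]_(2 * 2)).
Proof. by exists 0, (fun=> 0), (fun=> 0); split; [case | split; [case | rewrite big_ord0]]. Qed.

Lemma separable_addl (A B : 'M[C]_2) Q : psd2 A -> psd2 B -> separable Q ->
  separable (A *t B + Q).
Proof.
move=> hA hB [n [As [Bs [hAs [hBs ->]]]]].
exists n.+1, (fun k => oapp As A (unlift ord0 k)), (fun k => oapp Bs B (unlift ord0 k)).
split; first by move=> k; case: unliftP => [j|] _ /=; [exact: hAs | exact: hA].
split; first by move=> k; case: unliftP => [j|] _ /=; [exact: hBs | exact: hB].
rewrite big_ord_recl unlift_none; congr (_ + _).
by apply: eq_bigr => j _; rewrite liftK.
Qed.

(** Multiplying the completeness relation by [Q] keeps some of the effects and deletes the rest;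
    each effect kept is a product of two positive operators. *)
Lemma separable_of_leaves L (P : locc C L) Q : locc_wf P ->
  (forall Ml, In Ml (locc_leaves P) -> Ml.1 *m Q = Ml.1 \/ Ml.1 *m Q = 0) -> separable Q.
Proof.
move=> wf hQ; rewrite -[Q]mul1mx -(locc_complete wf) mulmx_suml.
have : forall Ml, In Ml (locc_leaves P) -> exists X Y : 'M[C]_2, Ml.1 = X *t Y.
  by move=> [M l] hM; have [X [Y [-> _]]] := in_fleaf hM; exists X, Y.
elim: (locc_leaves P) hQ => [|Ml s IH] hQ hT; first by rewrite big_nil; apply: separable0.
have IHs : separable (\sum_(x <- s) adj x.1 *m x.1 *m Q).
  by apply: IH => Nl hN; [apply: hQ; right | apply: hT; right].
rewrite big_cons -mulmxA.
have [X [Y ME]] : exists X Y : 'M[C]_2, Ml.1 = X *t Y by apply: hT; left.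
have [->|->] : Ml.1 *m Q = Ml.1 \/ Ml.1 *m Q = 0 by apply: hQ; left.
  rewrite ME adj_tens (tensmx_mul (adj X) (adj Y)).
  by apply: separable_addl => //; apply: psd2_adjM.
by rewrite mulmx0 add0r.
Qed.

(** Each leaf receives a label computed from the total operator of its branch; the function handed
    down multiplies in the operators already applied. This lets the outcome on the first copy select
    the protocol for the second. *)
Fixpoint relabel L L' (g : 'M[C]_(2 * 2) -> L') (P : locc C L) : locc C L' :=
  match P with
  | Leaf _ => Leaf (g 1%:M)
  | NodeA ks => NodeA [seq (kp.1, relabel (fun M => g (M *m (kp.1 *t 1%:M))) kp.2) | kp <- ks]
  | NodeB ks => NodeB [seq (kp.1, relabel (fun M => g (M *m (1%:M *t kp.1))) kp.2) | kp <- ks]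
  end.

Lemma relabel_wf L L' (g : 'M[C]_(2 * 2) -> L') (P : locc C L) :
  locc_wf P -> locc_wf (relabel g P).
Proof.
elim/locc_nested_ind: P g => [//|ks IH|ks IH] g.
- case/locc_wfA => h wf; apply/locc_wfA; split; first by rewrite big_map.
  by move=> _ /In_map[kp [kpks <-]]; apply: IH => //; apply: wf.
- case/locc_wfB => h wf; apply/locc_wfB; split; first by rewrite big_map.
  by move=> _ /In_map[kp [kpks <-]]; apply: IH => //; apply: wf.
Qed.

Lemma relabel_leaves L L' (g : 'M[C]_(2 * 2) -> L') (P : locc C L) Ml :
  In Ml (locc_leaves (relabel g P)) ->
  (exists l, In (Ml.1, l) (locc_leaves P)) /\ Ml.2 = g Ml.1.
Proof.
elim/locc_nested_ind: P g Ml => [l|ks IH|ks IH] g Ml.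
- by case=> [<-|//]; split=> //; exists l; left.
- case/in_leavesA => _ [Nl [/In_map[kp [kpks <-]] /= hN <-]] /=.
  have [[l hl] ->] := IH _ kpks _ _ hN; split=> //.
  by exists l; apply/in_leavesA; exists kp, (Nl.1, l).
- case/in_leavesB => _ [Nl [/In_map[kp [kpks <-]] /= hN <-]] /=.
  have [[l hl] ->] := IH _ kpks _ _ hN; split=> //.
  by exists l; apply/in_leavesB; exists kp, (Nl.1, l).
Qed.

(** The expression is the value at the vector with entries 1 and [y] of a sesquilinear form with
    diagonal [p], [-p]; the claim reflects that the numerical range of a traceless 2x2 matrix
    contains zero. *)
Lemma traceless_isotropic (p q r : C) :
  exists y : C, p + y * q + y^* * r - y^* * y * p = 0.
Proof.
case: (eqVneq p 0) => [->|p0]; first by exists 0; rewrite conjC0; ring.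
have [q' qE] : exists q', q = p * q' by exists (q / p); rewrite mulrC divfK.
have [r' rE] : exists r', r = p * r' by exists (r / p); rewrite mulrC divfK.
(* The phase of [y] is fixed first, so that the cross terms become real. For [w = r' - q'^*] they
   equal the difference of the squared moduli of [r'] and [q']. *)
have [w [w0 wr]] : exists w : C, w != 0 /\ q' * w + r' * w^* \is Num.real.
  case: (eqVneq r' q'^*) => [->|h].
    exists 1; rewrite oner_eq0 conjC1 !mulr1; split=> //.
    by rewrite CrealE rmorphD /= conjCK addrC.
  exists (r' - q'^*); split; first by rewrite subr_eq0.
  rewrite CrealE !(rmorphD, rmorphM, rmorphN) /= !conjCK.
  by apply/eqP; ring.
set c := _ + _ in wr.
pose N := w * w^*; have N0 : 0 < N by rewrite mul_conjC_gt0.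
pose d := sqrtC (c ^+ 2 + 4 * N).
have d2 : d ^+ 2 = c ^+ 2 + 4 * N by rewrite sqrtCK.
have dr : d \is Num.real.
  apply/ger0_real; rewrite sqrtC_ge0 addr_ge0 ?real_exprn_even_ge0 //.
  by rewrite mulr_ge0 ?ler0n // ltW.
(* A root of the real quadratic [1 + s * c - s ^+ 2 * N = 0], whose discriminant [c ^+ 2 + 4 * N] is
   positive. *)
pose s := (c + d) / (2 * N).
have sr : s^* = s.
  apply/conj_Creal/realM; first exact: realD.
  by rewrite realV; apply: realM; [exact: realn | exact: gtr0_real].
exists (s * w).
rewrite qE rE rmorphM /= sr.
transitivity (p * (1 - s ^+ 2 * N + s * c)); first by rewrite /N /c; ring.
have -> : 1 - s ^+ 2 * N + s * c = (4 * N + c ^+ 2 - d ^+ 2) / (4 * N).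
  by rewrite /s; field; rewrite gt_eqF.
by rewrite d2 [c ^+ 2 + _]addrC subrr mul0r mulr0.
Qed.

(** * One-way protocols for two states *)

Lemma ip_perpl (e : 'cV[C]_2) : ip (perp e) e = 0.
Proof. by rewrite -ip_conj ip_perp conjC0. Qed.

Local Opaque ip.

Section Slices.
Variable o : 'cV[C]_2.
Hypothesis o1 : ip o o = 1.

(* Bob's unnormalised state once Alice has projected [w] onto [e]. *)
Definition slice (e : 'cV[C]_2) (w : 'cV[C]_(2 * 2)) : 'cV[C]_2 :=
  ip (kron e o) w *: o + ip (kron e (perp o)) w *: perp o.

Lemma unit_decomp f : f = ip o f *: o + ip (perp o) f *: perp o.
Proof. by rewrite -ip_decomp o1 scale1r. Qed.

Lemma ip_unit_decomp (v w : 'cV[C]_2) :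
  ip v w = ip v o * ip o w + ip v (perp o) * ip (perp o) w.
Proof. by rewrite {1}(unit_decomp w) ipDr !ipZr mulrC [X in _ + X]mulrC. Qed.

Lemma ip_slice f e w : ip f (slice e w) = ip (kron e f) w.
Proof.
have h x : ip x (slice e w) =
    ip x o * ip (kron e o) w + ip x (perp o) * ip (kron e (perp o)) w.
  by rewrite /slice ipDr !ipZr mulrC [X in _ + X]mulrC.
rewrite h [in RHS](unit_decomp f) kronDr !kronZr ipDl !ipZl.
by rewrite !ip_conj.
Qed.

Lemma sliceDl b (e e' : 'cV[C]_2) w :
  slice (e + b *: e') w = slice e w + b^* *: slice e' w.
Proof.
rewrite /slice !kronDl !kronZl 2!ipDl 2!ipZl !scalerDl scalerDr !scalerA -!addrA.
by congr (_ + _); rewrite addrCA.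
Qed.

(** Alice's measurement in the basis [e], [perp e] conserves inner products. For orthogonal [v] and
    [w] this says that the form sending [e] to the inner product of the two slices is traceless. *)
Lemma ip_slices e v w :
  ip (slice e v) (slice e w) + ip (slice (perp e) v) (slice (perp e) w) =
  ip e e * ip v w.
Proof.
have h x : ip (slice x v) (slice x w) = ip v (kron x o) * ip (kron x o) w +
    ip v (kron x (perp o)) * ip (kron x (perp o)) w.
  rewrite ip_unit_decomp !ip_slice -(ip_conj o) -(ip_conj (perp o)) !ip_slice.
  by rewrite !ip_conj.
have := congr1 (ip v) (kron_decomp e o w); rewrite o1 mulr1 ipZr => ->.
rewrite !h 3!ipDr 4!ipZr.
by congr (_ + _); congr (_ + _); rewrite mulrC.
Qed.

Lemma slices_orthogonal e v w : ip v w = 0 -> ip (slice e v) (slice e w) = 0 ->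
  ip (slice (perp e) v) (slice (perp e) w) = 0.
Proof.
move=> vw0 h; have := ip_slices e v w.
by rewrite [in LHS]h add0r => ->; rewrite vw0 (mulr0 (ip e e)).
Qed.

End Slices.
Local Opaque slice.

Lemma isotropic_combination (s0 s1 r0 r1 : 'cV[C]_2) : ip s0 r0 + ip s1 r1 = 0 ->
  exists y : C, ip (s0 + y^* *: s1) (r0 + y^* *: r1) = 0.
Proof.
move/eqP; rewrite addrC addr_eq0 => /eqP tr.
have [y hy] := traceless_isotropic (ip s0 r0) (ip s1 r0) (ip s0 r1); exists y.
rewrite ipDl !ipDr !ipZl !ipZr conjCK tr -[RHS]hy.
by move: (ip s0 r0) (ip s0 r1) (ip s1 r0) => p q r; ring.
Qed.

(** Bob's final basis: outcome [f] rules out [r], and [perp f] rules out [s]. Either slice may be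
    zero, hence the case split. *)
Lemma orthogonal_pair_basis (s r : 'cV[C]_2) : ip s r = 0 ->
  exists f, [/\ f != 0, ip f r = 0 & ip (perp f) s = 0].
Proof.
move=> sr; case: (eqVneq s 0) => [->|s0]; last by exists s; rewrite ip_perpl.
case: (eqVneq r 0) => [->|r0]; last by exists (perp r); rewrite perp_eq0 ip_perpl ip0r.
by exists (delta_mx 0 0); rewrite !ip0r delta_neq0.
Qed.

Section Distinguishing.
Variable psi : 'I_4 -> 'cV[C]_(2 * 2).
Hypothesis psi_on : orthonormal4 psi.

(* Walgate et al.: the sesquilinear form [e |-> <slice e psi_i, slice e psi_j>] is
   traceless, so Alice can choose a basis [e, perp e] on which it vanishes; Bob is then
   left with orthogonal states. *)
Lemma pair_distinguishable i j : i != j ->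
  exists P : locc C unit, locc_wf P /\ forall Ml, In Ml (locc_leaves P) ->
    Ml.1 *m psi i = 0 \/ Ml.1 *m psi j = 0.
Proof.
move=> ij; have ip0 : ip (psi i) (psi j) = 0 by rewrite ip_psi // (negbTE ij).
have [o o1] : exists o : 'cV[C]_2, ip o o = 1.
  by exists (delta_mx 0 0); rewrite ip2E !mxE /= conjC1 conjC0 mulr1 mulr0 addr0.
have tr := ip_slices o1 o (psi i) (psi j); rewrite ip0 mulr0 in tr.
have [y hy] := isotropic_combination tr.
have [e [e0 eE]] : exists e, e != 0 /\ ip (slice o e (psi i)) (slice o e (psi j)) = 0.
  exists (o + y *: perp o); split; last first.
    by rewrite (sliceDl o y o (perp o) (psi i)) (sliceDl o y o (perp o) (psi j)).
  apply: contra_eq_neq o1 => e0; have : ip o (o + y *: perp o) = 0 by rewrite e0 ip0r.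
  by rewrite ipDr ipZr ip_perp mulr0 addr0 => ->; rewrite eq_sym oner_eq0.
have eE' : ip (slice o (perp e) (psi i)) (slice o (perp e) (psi j)) = 0.
  exact: (slices_orthogonal o1 ip0 eE).
have [f [f0 hf hf']] := orthogonal_pair_basis eE.
have [g [g0 hg hg']] := orthogonal_pair_basis eE'.
have [P [wf hP]] := one_wayA e0 f0 g0; exists P; split=> // Ml /hP[x [z [hxy hk]]].
case: hxy hk => -[-> [] ->] hk.
- by right; apply: hk; rewrite -(ip_slice o1).
- by left; apply: hk; rewrite -(ip_slice o1).
- by right; apply: hk; rewrite -(ip_slice o1).
- by left; apply: hk; rewrite -(ip_slice o1).
Qed.

(** Orthogonal products are orthogonal on one side, and that party measures first. Both states then
    belong, up to scalars, to a one-way product basis: their own outcomes eliminate all other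
    states, and the two remaining outcomes eliminate both of them. *)
Lemma product_pair i j : i != j -> ~ entangled (psi i) -> ~ entangled (psi j) ->
  exists P : locc C unit, locc_wf P /\ forall Ml, In Ml (locc_leaves P) ->
    (exists2 m, m \in [set i; j] & forall k, k != m -> Ml.1 *m psi k = 0) \/
    (Ml.1 *m psi i = 0 /\ Ml.1 *m psi j = 0).
Proof.
move=> ij /boolp.contrapT[a [b iE]] /boolp.contrapT[a' [b' jE]].
rewrite -kronE in iE; rewrite -kronE in jE.
have /norP[a0 b0] : ~~ ((a == 0) || (b == 0)) by rewrite -kron_eq0 -iE psi_neq0.
have /norP[a'0 b'0] : ~~ ((a' == 0) || (b' == 0)) by rewrite -kron_eq0 -jE psi_neq0.
have only c x y m : psi m = c *: kron x y -> forall k, k != m -> ip (kron x y) (psi k) = 0.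
  move=> mE k km; have c0 := par_neq0 (psi_neq0 psi_on m) mE.
  have := ip_psi psi_on m k; rewrite mE ipZl eq_sym (negbTE km) => /eqP.
  by rewrite mulf_eq0 conjC_eq0 (negbTE c0) => /eqP.
have iE1 : psi i = 1 *: kron a b by rewrite scale1r.
have jE1 : psi j = 1 *: kron a' b' by rewrite scale1r.
have /eqP : ip a a' * ip b b' = 0 by rewrite -ip_kron -iE -jE ip_psi // (negbTE ij).
rewrite mulf_eq0 => /orP[/eqP/(perp_par a0)[c a'E]|/eqP/(perp_par b0)[c b'E]].
- have jE2 : psi j = c *: kron (perp a) b' by rewrite jE a'E kronZl.
  have [P [wf hP]] := one_wayA a0 b0 b'0; exists P; split=> // Ml /hP[x [y [hxy hk]]].
  case: hxy => -[xE [] yE]; subst x y; [left; exists i|right|left; exists j|right].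
  + by rewrite !inE eqxx.
  + by move=> k ki; apply: hk; apply: only iE1 _ ki.
  + by split; apply: hk; [rewrite iE ip_kron (ip_perpl b) |
      rewrite jE2 ipZr ip_kron (ip_perp a)]; rewrite ?mul0r ?mulr0.
  + by rewrite !inE eqxx orbT.
  + by move=> k kj; apply: hk; apply: only jE2 _ kj.
  + by split; apply: hk; [rewrite iE ip_kron (ip_perpl a) |
      rewrite jE2 ipZr ip_kron (ip_perpl b')]; rewrite ?mul0r ?mulr0.
- have jE2 : psi j = c *: kron a' (perp b) by rewrite jE b'E kronZr.
  have [P [wf hP]] := one_wayB b0 a0 a'0; exists P; split=> // Ml /hP[x [y [hxy hk]]].
  case: hxy => -[yE [] xE]; subst x y; [left; exists i|right|left; exists j|right].
  + by rewrite !inE eqxx.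
  + by move=> k ki; apply: hk; apply: only iE1 _ ki.
  + by split; apply: hk; [rewrite iE ip_kron (ip_perpl a) |
      rewrite jE2 ipZr ip_kron (ip_perp b)]; rewrite ?mul0r ?mulr0.
  + by rewrite !inE eqxx orbT.
  + by move=> k kj; apply: hk; apply: only jE2 _ kj.
  + by split; apply: hk; [rewrite iE ip_kron (ip_perpl b) |
      rewrite jE2 ipZr ip_kron (ip_perpl a')]; rewrite ?mul0r ?mulr0.
Qed.

Lemma proj_psi i k : proj (psi i) *m psi k = (i == k)%:R *: psi i.
Proof. by rewrite /proj rank1_mulmx ip_psi. Qed.

(** [Q] fixes the two states and kills the others, while each outcome kills one of the two groups.
    So [Q], and likewise its complement, either preserves or annihilates each outcome operator. *)
Lemma separates_separable i j : i != j -> locc_separates_group psi [set i; j] ->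
  separable (proj (psi i) + proj (psi j)) /\
  separable (1%:M - (proj (psi i) + proj (psi j))).
Proof.
move=> ij [P [wf hP]]; set Q := proj _ + _.
have inQ k : k \in [set i; j] -> Q *m psi k = psi k.
  rewrite !inE mulmxDl !proj_psi => /orP[]/eqP->; rewrite eqxx scale1r.
    by rewrite eq_sym (negbTE ij) scale0r addr0.
  by rewrite (negbTE ij) scale0r add0r.
have notinQ k : k \notin [set i; j] -> Q *m psi k = 0.
  rewrite !inE mulmxDl !proj_psi => /norP[ki kj].
  by rewrite eq_sym (negbTE ki) eq_sym (negbTE kj) !scale0r addr0.
have key Ml : In Ml (locc_leaves P) -> Ml.1 *m Q = Ml.1 \/ Ml.1 *m Q = 0.
  move=> /hP[h|h]; [left|right]; apply: (basis_ext psi_on) => k; rewrite -mulmxA.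
    by case: (boolP (k \in [set i; j])) => kG; [rewrite inQ | rewrite notinQ // mulmx0 h].
  rewrite mul0mx.
  by case: (boolP (k \in [set i; j])) => kG; [rewrite inQ // h | rewrite notinQ // mulmx0].
split; apply: (separable_of_leaves wf) => // Ml /key[] h; rewrite mulmxBr mulmx1 h.
  by right; rewrite subrr.
by left; rewrite subr0.
Qed.

Lemma product_pair_separates i j : i != j -> ~ entangled (psi i) -> ~ entangled (psi j) ->
  locc_separates_group psi [set i; j].
Proof.
move=> ij hi hj; have [P [wf hP]] := product_pair ij hi hj.
exists P; split=> // Ml /hP[[m mG hm]|[h1 h2]]; [left=> k kG | right=> k].
  by apply: hm; apply: contraNneq kG => ->.
by rewrite !inE => /orP[]/eqP->.
Qed.

Definition distinguishes (P : locc C unit) (T : {set 'I_4}) : Prop :=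
  forall Ml, In Ml (locc_leaves P) -> forall i k, i \in T -> k \in T ->
    Ml.1 *m psi i != 0 -> Ml.1 *m psi k != 0 -> i = k.

Lemma two_stage G (P Q : locc C unit) : locc_separates_group psi G ->
  locc_wf P -> locc_wf Q -> distinguishes P G -> distinguishes Q (~: G) ->
  two_copy_adaptive_locc psi.
Proof.
move=> [S [wf hS]] wfP wfQ hP hQ.
(* An outcome that eliminates both groups is sent to [P]; this is harmless, as no state survives
   there. *)
pose g (M : 'M[C]_(2 * 2)) := if [forall k in ~: G, M *m psi k == 0] then P else Q.
exists (relabel g S); split; first exact: relabel_wf.
move=> Ml /relabel_leaves[[l /hS/= hM] ->]; rewrite /g.
case: forall_inP => h; split=> // Nl hN i k hi hi' hk hk'.
  have inG m : Ml.1 *m psi m != 0 -> m \in G.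
    by move=> hm; apply: contraNT hm => mG; apply: h; rewrite inE.
  exact: hP hN _ _ (inG _ hi) (inG _ hk) hi' hk'.
case: hM => [hM|hM]; first by case: h => m; rewrite inE => mG; rewrite hM.
have outG m : Ml.1 *m psi m != 0 -> m \in ~: G.
  by move=> hm; rewrite inE; apply: contraNN hm => mG; rewrite hM.
exact: hQ hN _ _ (outG _ hi) (outG _ hk) hi' hk'.
Qed.

Lemma pair_distinguishes i j : i != j ->
  exists P : locc C unit, locc_wf P /\ distinguishes P [set i; j].
Proof.
move=> /pair_distinguishable[P [wf hP]]; exists P; split=> // Ml /hP hM a b.
rewrite !inE => /orP[]/eqP-> /orP[]/eqP-> // h1 h2.
all: by case: hM h1 h2 => ->; rewrite eqxx.
Qed.

End Distinguishing.

(** * Two copies *)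

Section Necessity.
Variable psi : 'I_4 -> 'cV[C]_(2 * 2).
Hypothesis psi_on : orthonormal4 psi.

Lemma product_dichotomy :
  (exists i j, [/\ i != j, ~ entangled (psi i) & ~ entangled (psi j)]) \/
  (exists i0, forall k, k != i0 -> entangled (psi k)).
Proof.
case: (boolp.pselect (exists i, ~ entangled (psi i))) => [[i hi]|hno].
  case: (boolp.pselect (exists j, j != i /\ ~ entangled (psi j))) => [[j [ji hj]]|hj].
    by left; exists i, j; rewrite eq_sym ji.
  right; exists i => k ki; apply: boolp.contrapT => hk.
  by apply: hj; exists k.
by right; exists ord0 => k _; apply: boolp.contrapT => hk; apply: hno; exists k.
Qed.

(** An outcome of [Q] leaves at most one state of [T] and at most the single state outside it, hence
    at most two. Two outcomes with complementary survivors then cover [T] with at most two of its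
    three elements. *)
Lemma three_survivors i0 (T : {set 'I_4}) (Q : locc C unit) :
  (forall k, k != i0 -> entangled (psi k)) -> #|T| = 3%N ->
  locc_wf Q -> distinguishes psi Q T -> False.
Proof.
move=> ent T3 wf hQ.
have card_le1 Ml : In Ml (locc_leaves Q) -> (#|T :&: surv psi Ml.1| <= 1)%N.
  move=> hM; apply/card_le1_eqP => i k; rewrite !inE => /andP[hi hi'] /andP[hk hk'].
  exact: hQ hM _ _ hk hi hk' hi'.
have TC : #|~: T| = 1%N by apply/eqP; rewrite -(eqn_add2l #|T|) cardsC card_ord T3.
have le2 Ml : In Ml (locc_leaves Q) -> (#|surv psi Ml.1| <= 2)%N.
  move=> hM; have h2 : (#|surv psi Ml.1 :\: T| <= 1)%N.
    by apply: (leq_trans _ (eq_leq TC)); apply: subset_leq_card; rewrite setDE subsetIr.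
  by rewrite -(cardsID T (surv psi Ml.1)); apply: (@leq_add _ _ 1 1 _ h2); rewrite setIC card_le1.
have [Ml [Ml' [hM hM' E]]] := complementary_leaves psi_on ent wf le2.
have := leq_add (card_le1 _ hM) (card_le1 _ hM').
by rewrite E -setDE cardsID T3.
Qed.

Lemma two_copy_necessary : two_copy_adaptive_locc psi ->
  locc_perfect psi \/ exists i j, i != j /\ locc_separates_group psi [set i; j].
Proof.
move=> [S [wf hS]].
case: product_dichotomy => [[i [j [ij hi hj]]]|[i0 ent]].
  by right; exists i, j; split; [|apply: product_pair_separates].
have inT Ml : In Ml (locc_leaves S) -> distinguishes psi Ml.2 (surv psi Ml.1).
  move=> /hS[_ h] Nl hN i k; rewrite !inE => hi hk hi' hk'.
  exact: h hN _ _ hi hi' hk hk'.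
case: (has_In (fun Ml => #|surv psi Ml.1| == 4%N) (locc_leaves S)) => [[Ml [hM /eqP M4]]|h4].
  left; exists Ml.2; split=> [|Nl hN i k hi hk]; first by case: (hS _ hM).
  have allT m : m \in surv psi Ml.1.
    have /eqP-> : surv psi Ml.1 == setT by rewrite eqEcard subsetT cardsT card_ord M4.
    by rewrite inE.
  exact: (inT _ hM _ hN _ _ (allT i) (allT k) hi hk).
have [G [G2 hG]] : exists G : {set 'I_4}, #|G| = 2%N /\ locc_separates_group psi G.
  apply: (core psi_on ent wf) => Ml hM.
  have le4 : (#|surv psi Ml.1| <= 4)%N by rewrite -[X in (_ <= X)%N](card_ord 4) max_card.
  have ne4 : #|surv psi Ml.1| != 4%N.
    by apply/negP => M4; apply: h4; exists Ml.
  have ne3 : #|surv psi Ml.1| != 3%N.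
    apply/eqP => M3; have [wfQ _] := hS _ hM.
    exact: (three_survivors ent M3 wfQ (inT _ hM)).
  by move: le4 ne4 ne3; case: #|_| => [|[|[|[|[]]]]].
have /cards2P[i [j [ij GE]]] : #|G| == 2%N by rewrite G2.
by right; exists i, j; split=> //; rewrite -GE.
Qed.

Lemma two_copy_of_perfect : locc_perfect psi -> two_copy_adaptive_locc psi.
Proof.
move=> [P [wf hP]]; exists (Leaf P); split=> // _ [<-|//]; split=> //= Ml hM i k _ hi _ hk.
exact: hP hM _ _ hi hk.
Qed.

Lemma two_copy_of_pair i j : i != j -> locc_separates_group psi [set i; j] ->
  two_copy_adaptive_locc psi.
Proof.
move=> ij hG.
have [P [wfP hP]] := pair_distinguishes psi_on ij.
have : #|~: [set i; j]| == 2%N.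
  by rewrite -(eqn_add2l #|[set i; j]|) cardsC card_ord cards2 ij.
case/cards2P => k [l [kl GE]].
have [Q [wfQ hQ]] := pair_distinguishes psi_on kl.
by apply: (two_stage hG wfP wfQ hP); rewrite GE.
Qed.

(** Two of the three states other than [psi l] are products. The protocol of [product_pair] for them
    either leaves a single survivor or eliminates both, and then only the third state remains in the
    complement. *)
Lemma two_copy_of_single l : locc_separates_group psi [set l] ->
  (forall k1 k2, k1 \notin [set l] -> k2 \notin [set l] ->
     entangled (psi k1) -> entangled (psi k2) -> k1 = k2) ->
  two_copy_adaptive_locc psi.
Proof.
move=> hG hent.
have [i [j [ij il jl hi hj]]] : exists i j, [/\ i != j, i != l, j != l,
    ~ entangled (psi i) & ~ entangled (psi j)].
  have : (2 < #|~: [set l]|)%N by rewrite -(ltn_add2l #|[set l]|) cardsC card_ord cards1.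
  case/card_gt2P => a [b [c [[]]]]; rewrite !inE => al bl cl [ab bc ca].
  have clash x y : x != l -> y != l -> x != y -> entangled (psi x) -> ~ entangled (psi y).
    move=> xl yl /eqP xy hx hy; apply: xy.
    by apply: hent hx hy; rewrite inE.
  case: (boolp.pselect (entangled (psi a))) => ha.
    exists b, c; split=> //; first exact: clash ha.
    by apply: clash ha => //; rewrite eq_sym.
  case: (boolp.pselect (entangled (psi b))) => hb; last by exists a, b.
  by exists a, c; split=> //; [rewrite eq_sym | exact: clash hb].
have [Q [wfQ hQ]] := product_pair psi_on ij hi hj.
apply: (two_stage (P := Leaf tt) hG _ wfQ) => //.
  by move=> Ml _ a b; rewrite !inE => /eqP-> /eqP->.
move=> Ml /hQ[[m _ hm]|[h1 h2]] a b; rewrite !inE => al bl ha hb.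
  have only c : Ml.1 *m psi c != 0 -> c = m.
    by move=> hc; apply/eqP; apply: contraNT hc => /hm ->.
  by rewrite (only _ ha) (only _ hb).
have notij c : Ml.1 *m psi c != 0 -> (c != i) && (c != j).
  by move=> hc; apply/andP; split; apply: contraNneq hc => ->; rewrite ?h1 ?h2.
have /andP[ai aj] := notij _ ha; have /andP[bi bj] := notij _ hb.
apply/eqP; apply: contraT => ab.
(* Two distinct survivors besides [i], [j] and [l] would give five different indices below four. *)
have : uniq [:: a; b; i; j; l] by rewrite /= !inE !negb_or ab ai aj al bi bj bl ij il jl.
by move=> /card_uniqP h; have := max_card (mem [:: a; b; i; j; l]); rewrite h card_ord.
Qed.

End Necessity.

End TwoQubit.

Theorem theorem1 (R : realType) (psi : 'I_4 -> 'cV[R[i]]_(2 * 2)) :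
  orthonormal4 psi ->
  (two_copy_adaptive_locc psi <->
     [\/ locc_perfect psi,
         (exists l : 'I_4,
            locc_separates_group psi [set l] /\
            (forall k1 k2 : 'I_4, k1 \notin [set l] -> k2 \notin [set l] ->
               entangled (psi k1) -> entangled (psi k2) -> k1 = k2))
       | (exists i j : 'I_4,
            [/\ i != j,
                locc_separates_group psi [set i; j],
                separable (proj (psi i) + proj (psi j)) &
                separable (1%:M - (proj (psi i) + proj (psi j)))])]).
Proof.
move=> psi_on; split=> [/(two_copy_necessary psi_on)[h|[i [j [ij h]]]]|
                        [h|[l [h hent]]|[i [j [ij h _ _]]]]].
- by constructor 1.
- constructor 3; exists i, j.
  by have [] := separates_separable psi_on ij h.
- exact: two_copy_of_perfect.
- exact: two_copy_of_single hent.
- exact: two_copy_of_pair ij h.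
Qed.
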